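(* Let $i=\sqrt{-1}$. There exists a non-constant arithmetic progression of five squares properly defined over a quadratic extension $K$ of (1) $\mathbb Q(i)$ if and only if $K=\mathbb Q(i,\sqrt2)$; in this case $(-2,-1,0,1,2)$ is the unique, up to equivalence, non-constant arithmetic progression of five squares properly defined over $K$. (2) $\mathbb Q(\sqrt3)$ if and only if $K=\mathbb Q(\sqrt3,\sqrt2)$; in this case $(0,1,2,3,4)$ is the unique, up to equivalence, non-constant arithmetic progression of five squares properly defined over $K$. (3) $\mathbb Q(\sqrt2)$ if and only if $K=\mathbb Q(\sqrt2,\sqrt3)$, $K=\mathbb Q(\sqrt2,i)$, or $K=\mathbb Q(\sqrt2,\sqrt{\alpha})$ for some square-free $\alpha\in\mathbb Q(\sqrt2)$. In the first case $(0,1,2,3,4)$ is the unique, up to equivalence, non-constant arithmetic progression of five squares properly defined over $\mathbb Q(\sqrt2,\sqrt3)$; in the second case $(-2,-1,0,1,2)$ is the unique, up to equivalence, non-constant arithmetic progression of five squares properly defined over $\mathbb Q(\sqrt2,i)$; in the last case a non-constant arithmetic progression of five squares properly defined over $K$ is, up to equivalence, of the form $(a^2,b^2,c^2,\alpha d^2,e^2)$ with $a,b,c,d,e\in\mathbb Q(\sqrt2)$. (4) $\mathbb Q(\sqrt{-2})$ if and only if $K=\mathbb Q(\sqrt{-2},i)$ or $K=\mathbb Q(\sqrt{-2},\sqrt{\alpha})$ for some square-free $\alpha\in\mathbb Q(\sqrt{-2})$. In the first case $(-2,-1,0,1,2)$ is the unique, up to equivalence, non-constant arithmetic progression of five squares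 properly defined over $\mathbb Q(\sqrt{-2},i)$; in the second case a non-constant arithmetic progression of five squares properly defined over $K$ is, up to equivalence, of the form $(a^2,b^2,c^2,\alpha d^2,e^2)$ with $a,b,c,d,e\in\mathbb Q(\sqrt{-2})$.
   Context: For a field $F$ and $a_1,\dots,a_n\in F$, $(a_1^2,\dots,a_n^2)$ is an arithmetic progression of $n$ squares if $a_{j+1}^2-a_j^2$ is independent of $j$; it is non-constant if not all $a_j^2$ are equal. Two such progressions are equivalent under the equivalence relation generated by $(a_1^2,\dots,a_n^2)\sim(s^2a_1^2,\dots,s^2a_n^2)$ for $s\in F^*$ and $(a_1^2,\dots,a_n^2)\sim(a_n^2,\dots,a_1^2)$. The progression is properly defined over a number field $K$ if $a_1,\dots,a_n\in K$ and $\{a_1,\dots,a_n\}$ is not contained in any proper subfield of $K$.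
   Formalization: ''Properly defined'' is required of every equivalent progression, since literally (1), (2) fail, e.g. over Q(i,√409). In (3), (4) the α case asks that K carry a progression of the stated form, as every quadratic K is some k(√α); the form is claimed for K not listed earlier. *)

(* Defs.v *)
From mathcomp Require Import all_boot all_order all_algebra all_field.
From Stdlib Require Import Relations.
Set Implicit Arguments.
Unset Strict Implicit.
Unset Printing Implicit Defensive.
Import GRing.Theory.
Local Open Scope ring_scope.

(* A number field is a K : fieldExtType rat.  The tuple a lists the roots
   a_1, ..., a_n; the progression itself is the tuple of their squares. *)

Definition sqs (K : fieldExtType rat) n (a : n.-tuple K) : n.-tuple K :=
  [tuple of map (fun x => x ^+ 2) a].

Definition is_ap (K : fieldExtType rat) n (u : n.-tuple K) : Prop :=
  exists d : K, forall j : nat, (j.+1 < n)%N -> u`_j.+1 - u`_j = d.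

Definition nonconstant (K : fieldExtType rat) n (u : n.-tuple K) : Prop :=
  exists j k : 'I_n, tnth u j <> tnth u k.

Definition ap_step (K : fieldExtType rat) n (u v : n.-tuple K) : Prop :=
  (exists2 s : K, s != 0 & v = [tuple of map (fun x => s ^+ 2 * x) u])
  \/ v = [tuple of rev u].

Definition ap_equiv (K : fieldExtType rat) n :
  n.-tuple K -> n.-tuple K -> Prop := clos_refl_sym_trans _ (@ap_step K n).

Definition generates (K : fieldExtType rat) n (a : n.-tuple K) : Prop :=
  forall L : {subfield K}, {subset a <= L} -> (L : {vspace K}) = fullv.

(* Progressions are considered up to equivalence, but [generates] is not
   invariant under scaling: (7, 13, 17, sqrt 409, 23), which lives over
   Q(sqrt 409), generates Q('i, sqrt 409) once multiplied by 1 + 'i.  Being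
   properly defined is therefore required of every equivalent progression,
   i.e. the class has no representative over a proper subfield. *)
Definition properly_defined (K : fieldExtType rat) n (a : n.-tuple K) : Prop :=
  forall b : n.-tuple K, ap_equiv (sqs a) (sqs b) -> generates b.

Definition nc_proper_ap (K : fieldExtType rat) n (a : n.-tuple K) : Prop :=
  [/\ is_ap (sqs a), nonconstant (sqs a) & properly_defined a].

Definition unique_nc_proper_ap (K : fieldExtType rat) n (u : n.-tuple K) :=
  (exists2 a : n.-tuple K, nc_proper_ap a & sqs a = u)
  /\ (forall b : n.-tuple K, nc_proper_ap b -> ap_equiv (sqs b) u).

Definition quadratic_over (K : fieldExtType rat) (k : {subfield K}) : Prop :=
  \dim_k {:K} = 2%N.

Definition is_adjoin_sqrt (K : fieldExtType rat) (k : {subfield K}) (x : K) :=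
  exists2 s : K, s ^+ 2 = x & <<k; s>>%VS = fullv.

Definition is_integer_of (K : fieldExtType rat) (k : {subfield K}) (x : K) :=
  x \in k /\ integralOver (intr : int -> K) x.

(* In particular x <> 0, since 0 is divisible by 0 ^+ 2. *)
Definition squarefree_in (K : fieldExtType rat) (k : {subfield K}) (x : K) :=
  is_integer_of k x /\
  forall y z : K, is_integer_of k y -> is_integer_of k z -> x = y ^+ 2 * z ->
    exists2 y' : K, is_integer_of k y' & y * y' = 1.

Definition of_form (K : fieldExtType rat) (k : {subfield K}) (alpha : K)
    (u : 5.-tuple K) : Prop :=
  exists a b c d e : K,
    [/\ a \in k, b \in k, c \in k, d \in k & e \in k] /\
    u = [tuple a ^+ 2; b ^+ 2; c ^+ 2; alpha * d ^+ 2; e ^+ 2].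

(* K is the quadratic extension k(sqrt alpha) attached to a progression
   (a^2, b^2, c^2, alpha d^2, e^2) with a, b, c, d, e in k. *)
Definition alpha_case (K : fieldExtType rat) (k : {subfield K}) : Prop :=
  exists alpha : K,
    [/\ squarefree_in k alpha, is_adjoin_sqrt k alpha
      & exists2 x : 5.-tuple K, nc_proper_ap x & of_form k alpha (sqs x)].

Definition alpha_form (K : fieldExtType rat) (k : {subfield K}) : Prop :=
  forall alpha : K, squarefree_in k alpha -> is_adjoin_sqrt k alpha ->
  forall x : 5.-tuple K, nc_proper_ap x ->
    exists2 u : 5.-tuple K, ap_equiv (sqs x) u & of_form k alpha u.

(* Main.v *)
(* Divided by the common difference D, the squares become u - 2, ..., u + 2 with
   u = x_2^2 / D.  Four of them yield a triple of squares w, w + m, w + n, a point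
   in twice the Mordell-Weil group of v^2 = w (w + m) (w + n): (m, n) = (1, 4) for four
   consecutive terms, (1, 9) when the middle one is omitted and (2, 6) when the fourth
   one is.  For d = -1, 3, 2, -2 an infinite 2-descent over Z shows that the twists by d
   of these curves have no such point (for (2, 6): if d = -1 or 3), nor do the untwisted
   ones for (1, 4) and (1, 9), up to torsion; hence the points over k = Q(sqrt d) are
   known.  Over K the sum of the (1, 4)-point with its conjugate is one of them, so
   conjugation fixes or reflects both four-term subprogressions; it cannot reflect both,
   so u lies in k, and either the (1, 9)-curve has a further point over k, which leaves
   only (-2, -1, 0, 1, 2) and (0, 1, 2, 3, 4), or exactly the second or the fourth term
   is irrational.  For d = -1, 3 the (2, 6)-curve shows that the latter progressions come
   from a quadratic field.  The biquadratic fields in the cases d = 2, -2 are quadratic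
   over Q(i) or Q(sqrt 3), which gives uniqueness there. *)
Require Import Defs.
From HB Require Import structures.
From mathcomp Require Import all_boot all_order all_algebra all_field.
From mathcomp Require Import zify ring lra.
From Stdlib Require Import Relations Classical.
Set Implicit Arguments.
Unset Strict Implicit.
Unset Printing Implicit Defensive.
Import Order.TTheory GRing.Theory Num.Theory.
Local Open Scope ring_scope.

(** * Two-descent over the integers *)

(** No group law is defined. A point of [v^2 = w (w + m) (w + n)] all of whose factors are squares
    is a triple [(s0, s1, s2)] with [s1^2 = s0^2 + m] and [s2^2 = s0^2 + n]. Only three operations
    are needed, each an explicit formula whose result is again such a triple: the sum and the
    difference of a point and its conjugate, and doubling. They carry statements over Z up to [K]:
    for [k] over Q the difference would be a point of the twist, which has none; for [K] over [k]
    the sum is defined over [k]. Accordingly the descent treats only abscissas that are squares,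
    that is, doubles: the half of such a point is again a double once its three square classes
    agree, and the denominator has then lost a factor 2. Points of small order escape this argument;
    they show up as small integers that would have to be squares in [k] or [K], which is refuted by
    computation. *)

Lemma int_half (x : int) : exists y : int, x = 2 * y \/ x = 2 * y + 1.
Proof. by exists (x %/ 2)%Z; lia. Qed.

(** [lra] works in an ordered ring and does not see parity, so parity contradictions are reached by
    writing out a polynomial [x] for which it derives [2 x = 1]. *)
Lemma double_neq1 (x : int) : 2 * x = 1 -> False.
Proof. lia. Qed.

(** The three shapes carry the 2-adic information and, through [0 <= k], the sign, so that
    conditions on squares become linear goals for [lia]. *)
Lemma sqr_mod32 (x : int) : exists2 k : int, 0 <= k &
  [\/ x ^+ 2 = 8 * k + 1, x ^+ 2 = 32 * k + 4 | x ^+ 2 = 16 * k].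
Proof.
have odd_sq (y : int) : exists2 k : int, 0 <= k & (2 * y + 1) ^+ 2 = 8 * k + 1.
  have [z [-> | ->]] := int_half y.
    exists (z * (2 * z + 1)); last by ring.
    by have : 0 <= z \/ z <= -1; [lia | case=> ?; nia].
  exists ((2 * z + 1) * (z + 1)); last by ring.
  by have : 0 <= z \/ z <= -1; [lia | case=> ?; nia].
have [y [-> | ->]] := int_half x; last first.
  by have [k k0 ->] := odd_sq y; exists k => //; constructor 1.
have [z [-> | ->]] := int_half y.
  by exists (z ^+ 2); [nia | constructor 3; ring].
have [k k0 e] := odd_sq z; exists k => //; constructor 2.
by rewrite exprMn e; ring.
Qed.

Lemma sqfree_decomp (a : nat) : (0 < a)%N ->
  exists s t : nat, a = (s * t ^ 2)%N /\ (forall p, prime p -> ~~ (p ^ 2 %| s)%N).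
Proof.
have [n] := ubnP a; elim: n a => // n IH a lan a0.
have [/hasP[p]|] := boolP (has (fun p => prime p && (p ^ 2 %| a)) (iota 0 a.+1))%N.
  move=> _ /andP[pp /dvdnP[b ab]]; subst a.
  have b0 : (0 < b)%N by move: a0; rewrite muln_gt0 => /andP[].
  have p1 := prime_gt1 pp.
  have [||s [t [bE sf]]] := IH b; [nia | by [] |].
  by exists s, (t * p)%N; split=> //; rewrite bE expnMn mulnA.
move/hasPn=> H; exists a, 1%N; rewrite exp1n muln1; split=> // p pp.
apply/negP=> pa; suff /H : p \in iota 0 a.+1 by rewrite pp pa.
rewrite mem_iota /= add0n ltnS; apply: (leq_trans _ (dvdn_leq a0 pa)).
by have := prime_gt1 pp; nia.
Qed.

(** A prime of [s] has odd valuation [1 + 2 v(t)] in [a]; if it divided neither [f] nor [m], the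
    right-hand side would give it the even valuation [2 v(b)]. *)
Lemma sqfree_part (a f m b : nat) : (0 < m)%N -> (0 < b)%N ->
  (a * f = m * b ^ 2)%N ->
  exists s t : nat, [/\ a = (s * t ^ 2)%N, (forall p, prime p -> ~~ (p ^ 2 %| s)%N)
    & (forall p, prime p -> p %| s -> (p %| f) || (p %| m))%N].
Proof.
move=> m0 b0 e.
have : (0 < a * f)%N by rewrite e muln_gt0 m0 expn_gt0 b0.
rewrite muln_gt0 => /andP[a0 f0].
have [s [t [aE sf]]] := sqfree_decomp a0; exists s, t; split=> // p pp ps.
have [s0 t0] : (0 < s)%N /\ (0 < t)%N by move: a0; rewrite aE; nia.
have ls : logn p s = 1%N.
  apply/eqP; rewrite eqn_leq -pfactor_dvdn // expn1 ps andbT -ltnS.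
  by rewrite ltnNge -pfactor_dvdn // sf.
apply/orP; have [|pf] := boolP (p %| f)%N; [by left | right].
apply/negPn/negP=> pm.
have := congr1 (logn p) e; rewrite aE !lognM ?lognX ?muln_gt0 ?expn_gt0 ?s0 ?t0 ?b0 //.
rewrite ls.
have -> : logn p f = 0%N by apply/eqP; rewrite -leqn0 leqNgt -pfactor_dvdn.
have -> : logn p m = 0%N by apply/eqP; rewrite -leqn0 leqNgt -pfactor_dvdn.
lia.
Qed.

Definition smooth23 (m : int) := all (mem [:: 2; 3]%N) (primes `|m|%N).

(* Up to squares an odd factor of [m b^2] prime to its cofactor away from [m]
   is [1], [-1], [3] or [-3]. *)
Definition class23 (m d : int) : Prop :=
  [\/ d = 1, d = -1 | (d = 3 \/ d = -3) /\ (3 %| `|m|)%N].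

Lemma class23P (a f m b : int) : m != 0 -> b != 0 -> smooth23 m ->
  a * f = m * b ^+ 2 -> (exists y, a = 2 * y + 1) ->
  (forall p, prime p -> p %| `|a| -> p %| `|f| -> p %| `|m|)%N ->
  exists d t : int, a = d * t ^+ 2 /\ class23 m d.
Proof.
move=> m0 b0 sm e [y ay] Hp.
have e' : (`|a| * `|f| = `|m| * `|b| ^ 2)%N by rewrite -abszM e abszM abszX.
have [||s [t [aE sf Hs]]] := sqfree_part _ _ e'; [lia | lia |].
have s0 : (0 < s)%N by nia.
have Hsm p : prime p -> (p %| s)%N -> (p %| `|m|)%N.
  move=> pp ps; have := Hs p pp ps; case/orP=> // pf; apply: Hp => //.
  by rewrite aE dvdn_mulr.
(* A prime of [s] divides [m], so it is 2 or 3, and 2 is excluded because [a] is odd; squarefreeness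
   then leaves [s = 1] or [s = 3]. *)
have Hs3 p : prime p -> (p %| s)%N -> p = 3%N.
  move=> pp ps; have pm := Hsm p pp ps.
  have : p \in primes `|m|%N by rewrite mem_primes pp pm /=; lia.
  move/(allP sm); rewrite /= !inE => /orP[/eqP p2|/eqP //].
  by move: ps; rewrite p2 => /dvdnP[j sj]; move: aE; rewrite sj; nia.
have : s = 1%N \/ (s = 3%N /\ (3 %| `|m|)%N).
  have [s1|s1] : s = 1%N \/ (1 < s)%N by lia.
    by left.
  right; have pp := pdiv_prime s1; have ps := pdiv_dvd s.
  move: (Hs3 _ pp ps) => p3; rewrite p3 in ps pp; split; last exact: Hsm.
  case/dvdnP: ps => j sj.
  have [j1|j1] : j = 1%N \/ (1 < j)%N by nia.
    by rewrite sj j1.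
  have pq := pdiv_prime j1; have pj := pdiv_dvd j.
  have q3 : pdiv j = 3%N by apply: Hs3 => //; rewrite sj dvdn_mulr.
  move: pj; rewrite q3 => /dvdnP[i ij].
  by have := sf 3%N isT; rewrite sj ij -mulnA dvdn_mull.
have : a = `|a|%N%:Z \/ a = - `|a|%N%:Z by lia.
rewrite aE => - [] ->.
  case=> [->|[-> m3]]; [exists 1, t%:Z | exists 3, t%:Z]; split.
  - by rewrite mul1n PoszM mul1r.
  - by constructor 1.
  - by rewrite PoszM.
  - by constructor 3; split; [left|].
case=> [->|[-> m3]]; [exists (-1), t%:Z | exists (-3), t%:Z]; split.
- by rewrite mul1n PoszM; ring.
- by constructor 2.
- by rewrite !PoszM; ring.
- by constructor 3; split; [right|].
Qed.

(* [a], [b], [c] are the halves of [A + C], [A + E], [C + E], with the signs of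
   [C] and [E] chosen to make them odd; [a b / be^2] is the abscissa of half the
   point with abscissa [(A / B)^2]. *)
Lemma half_point (m n A B C E : int) :
  (exists y, A = 2 * y + 1) -> (exists y, B = 2 * y) ->
  C ^+ 2 = A ^+ 2 + m * B ^+ 2 -> E ^+ 2 = A ^+ 2 + n * B ^+ 2 ->
  exists a b c be : int,
  [/\ B = 2 * be, A = a + b - c,
      [/\ exists y, a = 2 * y + 1, exists y, b = 2 * y + 1 & exists y, c = 2 * y + 1],
      a * c - a * b = m * be ^+ 2 & b * c - a * b = n * be ^+ 2].
Proof.
move=> [y Ay] [be Bb] hC hE.
(* [X] is odd like [A]; its sign is chosen so that it is congruent to [A] modulo 4, which makes its
   half-sum with [A] odd. *)
have odd_root (k X : int) : X ^+ 2 = A ^+ 2 + k * B ^+ 2 ->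
    exists Y z : int, Y = A + 4 * z /\ Y ^+ 2 = X ^+ 2.
  move=> hX; have [z [Xz|Xz]] := int_half X.
    case: (@double_neq1 (2 * (z ^+ 2 - y ^+ 2 - y - k * be ^+ 2))).
    by move: hX; rewrite Ay Bb Xz => hX; lra.
  have [t [zt|zt]] := int_half (z - y).
    by exists X, t; split=> //; lia.
  exists (- X); exists (- (t + y + 1)); split; [lia | ring].
have [C' [s [C'E hC']]] := odd_root _ _ hC; have [E' [t [E'E hE']]] := odd_root _ _ hE.
exists (A + 2 * s), (A + 2 * t), (A + 2 * s + 2 * t), be; split=> //.
- ring.
- by split; [exists (y + s) | exists (y + t) | exists (y + s + t)]; lia.
- by move: hC; rewrite -hC' C'E Bb => hC; lra.
- by move: hE; rewrite -hE' E'E Bb => hE; lra.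
Qed.

Lemma prime_dvdzX2 (p : nat) (m b : int) : prime p ->
  (p %| m * b ^+ 2)%Z = (p %| m)%Z || (p %| b)%Z.
Proof.
by move=> pp; rewrite !dvdzE abszM abszX Euclid_dvdM // Euclid_dvdX ?andbT.
Qed.

Definition odd_solution (m n A B C E : int) :=
  [/\ exists y, A = 2 * y + 1, C ^+ 2 = A ^+ 2 + m * B ^+ 2
    & E ^+ 2 = A ^+ 2 + n * B ^+ 2].

Definition even_denominator (m n : int) :=
  forall A B C E, odd_solution m n A B C E -> exists y, B = 2 * y.

(* The half of a point is divisible by two again when [da = db = dc]. *)
Definition trivial_classes (m n : int) :=
  forall da db dc x y z be : int,
  class23 m da -> class23 n db -> class23 (n - m) dc ->
  [/\ exists t, x = 2 * t + 1, exists t, y = 2 * t + 1 & exists t, z = 2 * t + 1] ->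
  be != 0 ->
  da * x ^+ 2 * (dc * z ^+ 2) - da * x ^+ 2 * (db * y ^+ 2) = m * be ^+ 2 ->
  db * y ^+ 2 * (dc * z ^+ 2) - da * x ^+ 2 * (db * y ^+ 2) = n * be ^+ 2 ->
  da = db /\ db = dc.

Lemma odd_factor (d t y : int) : d * t ^+ 2 = 2 * y + 1 -> exists s, t = 2 * s + 1.
Proof.
have [s [->|->]] := int_half t; last by exists s.
by move=> e; case: (@double_neq1 (2 * d * s ^+ 2 - y)); lra.
Qed.

Lemma coprime_descent (m n A B C E : int) :
  smooth23 m -> smooth23 n -> smooth23 (n - m) -> m != 0 -> n != 0 -> n - m != 0 ->
  even_denominator m n -> trivial_classes m n ->
  (forall p, prime p -> (p %| A)%Z -> (p %| B)%Z -> False) ->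
  B != 0 -> odd_solution m n A B C E ->
  exists A' B' C' E', [/\ odd_solution m n A' B' C' E', B' != 0 & B = 2 * B'].
Proof.
move=> sm sn snm m0 n0 nm0 even_den cls cop B0 sol.
have [oA hC hE] := sol; have eB := even_den _ _ _ _ sol.
have [a [b [c [be [Bbe Aabc [oa ob oc] e1 e2]]]]] := half_point oA eB hC hE.
have be0 : be != 0 by apply: contraNneq B0 => be0; rewrite Bbe be0 mulr0.
have Bdiv p : (p %| be)%Z -> (p %| B)%Z by move=> ?; rewrite Bbe dvdz_mull.
(* A prime dividing [a] and its cofactor divides [A], and it divides [m] or [B]; coprimality leaves
   [m]. *)
have [] := @class23P a (c - b) m be m0 be0 sm _ oa; first by lra.
  move=> p pp pa pcb; have pA : (p %| A)%Z.
    have -> : A = a - (c - b) by rewrite Aabc; ring.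
    by rewrite rpredB.
  suff : (p %| m * be ^+ 2)%Z.
    by rewrite prime_dvdzX2 // => /orP[//|/Bdiv]; move/(cop p pp pA).
  by rewrite -e1 -mulrBr dvdz_mulr.
move=> da [x [ax cda]].
have [] := @class23P b (c - a) n be n0 be0 sn _ ob; first by lra.
  move=> p pp pb pca; have pA : (p %| A)%Z.
    have -> : A = b - (c - a) by rewrite Aabc; ring.
    by rewrite rpredB.
  suff : (p %| n * be ^+ 2)%Z.
    by rewrite prime_dvdzX2 // => /orP[//|/Bdiv]; move/(cop p pp pA).
  by rewrite -e2 mulrC -mulrBl dvdz_mull.
move=> db [y [bx cdb]].
have e3 : c * (b - a) = (n - m) * be ^+ 2 by lra.
have [] := @class23P c (b - a) (n - m) be nm0 be0 snm e3 oc.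
  (* Here the difference of the two factors is [C], and [A^2 = C^2 - 4 m be^2] brings the prime back
     to [A]. *)
  move=> p pp pc pba; have pC : (p %| c - (b - a))%Z by rewrite rpredB.
  suff : (p %| (n - m) * be ^+ 2)%Z.
    rewrite prime_dvdzX2 // => /orP[//|pbe].
    case: (cop p pp); last exact: Bdiv.
    have : (p %| 1 * A ^+ 2)%Z.
      have -> : 1 * A ^+ 2 = (c - (b - a)) * (c - (b - a)) - be * (4 * m * be).
        by rewrite Aabc; lra.
      by rewrite rpredB ?dvdz_mulr.
    by rewrite prime_dvdzX2 // => /orP[|//]; rewrite dvdzE /= dvdn1 => /eqP p1; rewrite p1 in pp.
  by rewrite -e3 dvdz_mulr.
move=> dc [z [cx cdc]].
have ox : exists t, x = 2 * t + 1.
  by case: oa => t; rewrite ax; exact: odd_factor.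
have oy : exists t, y = 2 * t + 1.
  by case: ob => t; rewrite bx; exact: odd_factor.
have oz : exists t, z = 2 * t + 1.
  by case: oc => t; rewrite cx; exact: odd_factor.
rewrite ax bx cx in e1 e2.
have [dab dbc] := cls _ _ _ _ _ _ _ cda cdb cdc (And3 ox oy oz) be0 e1 e2.
(* With one class [d] for all three, [a b = (d x y)^2], and adding [m be^2] or [n be^2] gives
   [a c = (d x z)^2] or [b c = (d y z)^2]: a solution of the same shape with [B] halved. *)
exists (db * x * y), be, (db * x * z), (db * y * z); split=> //.
move: e1 e2; rewrite dab -dbc => e1 e2; split; [|lra|lra].
case: oa ob => ta ea [tb eb]; rewrite ea eb dab in ax bx *.
have [t [d2|d2]] := int_half (db * x * y); last by exists t.
have : (2 * ta + 1) * (2 * tb + 1) = (db * x * y) ^+ 2 by rewrite ax bx; ring.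
by rewrite d2 => e; case: (@double_neq1 (2 * t ^+ 2 - 2 * ta * tb - ta - tb)); lra.
Qed.

Lemma no_odd_solution (m n : int) :
  smooth23 m -> smooth23 n -> smooth23 (n - m) -> m != 0 -> n != 0 -> n - m != 0 ->
  even_denominator m n -> trivial_classes m n ->
  forall A B C E, odd_solution m n A B C E -> B = 0.
Proof.
move=> sm sn snm m0 n0 nm0 even_den cls A B C E.
have [N] := ubnP `|B|%N; elim: N A B C E => // N IH A B C E ltN sol.
apply/eqP/negPn/negP=> B0.
(* Either a common prime is divided out or the coprime descent halves [B]; both lower the absolute
   value of [B]. *)
have [/hasP[p _ /andP[/andP[pp pA] pB]]|/hasPn H] :=
  boolP (has (fun p => prime p && (p %| A)%Z && (p %| B)%Z) (iota 0 `|B|.+1)).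
  have p1 := prime_gt1 pp.
  case/dvdzP: (pA) => A' EA; case/dvdzP: (pB) => B' EB.
  have root k X : X ^+ 2 = A ^+ 2 + k * B ^+ 2 ->
      exists2 X', X = X' * p%:Z & X' ^+ 2 = A' ^+ 2 + k * B' ^+ 2.
    move=> hX; have : (p %| 1 * X ^+ 2)%Z.
      by rewrite mul1r hX EA EB !exprMn !expr2 !mulrA rpredD ?dvdz_mull.
    rewrite prime_dvdzX2 // => /orP[|/dvdzP[X' EX]].
      by rewrite dvdzE /= dvdn1 => /eqP pp1; rewrite pp1 in pp.
    exists X' => //; have p20 : p%:Z ^+ 2 != 0 by rewrite expf_neq0 //; lia.
    by apply: (mulIf p20); rewrite -exprMn -EX hX EA EB; ring.
  have [[y Ay] hC hE] := sol.
  have [C' _ hC'] := root _ _ hC; have [E' _ hE'] := root _ _ hE.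
  suff /(IH A' B' C' E') : (`|B'| < N)%N.
    suff sol' : odd_solution m n A' B' C' E' by move/(_ sol') => B'0; move: B0; rewrite EB B'0 mul0r.
    split=> //; have [t [tA|tA]] := int_half A'; last by exists t.
    case: (@double_neq1 (t * p%:Z - y)).
    by move: Ay; rewrite EA tA => Ay; lra.
  apply: leq_trans (ltN : (_ <= N)%N); rewrite EB abszM ltn_Pmulr //.
  by rewrite absz_gt0; apply: contraNneq B0 => B'0; rewrite EB B'0 mul0r.
have cop p : prime p -> (p %| A)%Z -> (p %| B)%Z -> False.
  move=> pp pA pB; have : p \in iota 0 `|B|.+1.
    by rewrite mem_iota /= add0n ltnS dvdn_leq ?absz_gt0.
  by move/H; rewrite pp pA pB.
have [A' [B' [C' [E' [sol' B'0 BB']]]]] :=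
  coprime_descent sm sn snm m0 n0 nm0 even_den cls cop B0 sol.
case/eqP: (B'0); apply: (IH A' B' C' E') => //.
by apply: leq_trans (ltN : (_ <= N)%N); rewrite BB' abszM ltn_Pmull // absz_gt0.
Qed.

(** * Congruence and sign conditions on the square classes *)

Lemma odd_sqr (y : int) : exists2 k : int, 0 <= k & (2 * y + 1) ^+ 2 = 8 * k + 1.
Proof.
have [k k0 [e|e|e]] := sqr_mod32 (2 * y + 1); first by exists k.
  by case: (@double_neq1 (16 * k + 2 - 2 * y ^+ 2 - 2 * y)); lra.
by case: (@double_neq1 (8 * k - 2 * y ^+ 2 - 2 * y)); lra.
Qed.

Definition sqr_form (s k : int) := [\/ s = 8 * k + 1, s = 32 * k + 4 | s = 16 * k].

Lemma even_denominator_linear (m n : int) :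
  (forall a b s t j k : int, sqr_form s j -> sqr_form t k ->
    s = 8 * a + 1 + m * (8 * b + 1) -> t = 8 * a + 1 + n * (8 * b + 1) -> False) ->
  even_denominator m n.
Proof.
move=> H A B C E [[y ->] hC hE]; have [z [->|Bz]] := int_half B; first by exists z.
have [a _ ea] := odd_sqr y; have [b _ eb] := odd_sqr z.
have [j _ hj] := sqr_mod32 C; have [k _ hk] := sqr_mod32 E.
by case: (H a b _ _ j k hj hk); rewrite ?hC ?hE Bz ea eb.
Qed.

Lemma even_denominators :
  [/\ even_denominator 1 4, even_denominator (-1) (-4), even_denominator 2 8,
      even_denominator (-2) (-8) & even_denominator 3 12] /\
  [/\ even_denominator 1 9, even_denominator (-1) (-9), even_denominator 2 18,
      even_denominator (-2) (-18) & even_denominator 3 27] /\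
  even_denominator (-2) (-6) /\ even_denominator 6 18.
Proof. by split; [split|split; [split|split]]; 
  apply: even_denominator_linear => a b s t j k [] ? [] ? ? ?; lia. Qed.

Lemma odd_prod_sqr (x y : int) : (exists t, x = 2 * t + 1) -> (exists t, y = 2 * t + 1) ->
  exists2 k : int, 0 <= k & (x * y) ^+ 2 = 8 * k + 1.
Proof.
move=> [s ->] [t ->]; have [k k0 e] := odd_sqr (2 * s * t + s + t).
by exists k => //; rewrite -e; congr (_ ^+ 2); ring.
Qed.

(** The classes enter only through their products, so the equations are linear in the odd squares
    [8 U + 1], [8 V + 1], [8 W + 1] and in [s = be^2]; residues and signs decide most triples of
    classes. The first alternative in the conclusion of the hypothesis is the exit for the triples
    that need an argument modulo 3. *)
Lemma trivial_classes_linear (m n : int) :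
  (forall da db dc U V W s k : int,
    class23 m da -> class23 n db -> class23 (n - m) dc ->
    0 <= U -> 0 <= V -> 0 <= W -> 0 <= k ->
    sqr_form s k -> 0 < s ->
    da * dc * (8 * V + 1) - da * db * (8 * U + 1) = m * s ->
    db * dc * (8 * W + 1) - da * db * (8 * U + 1) = n * s ->
    (forall p q r be : int, be != 0 -> da * dc * q ^+ 2 - da * db * p ^+ 2 = m * be ^+ 2 ->
      db * dc * r ^+ 2 - da * db * p ^+ 2 = n * be ^+ 2 -> False) \/ (da = db /\ db = dc)) ->
  trivial_classes m n.
Proof.
move=> H da db dc x y z be ca cb cc [ox oy oz] be0 e1 e2.
have [U U0 eU] := odd_prod_sqr ox oy; have [V V0 eV] := odd_prod_sqr ox oz.
have [W W0 eW] := odd_prod_sqr oy oz; have [k k0 ek] := sqr_mod32 be.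
have e1' : da * dc * (x * z) ^+ 2 - da * db * (x * y) ^+ 2 = m * be ^+ 2.
  by rewrite -e1; ring.
have e2' : db * dc * (y * z) ^+ 2 - da * db * (x * y) ^+ 2 = n * be ^+ 2.
  by rewrite -e2; ring.
have s0 : 0 < be ^+ 2 by rewrite exprn_even_gt0.
have [||/(_ _ _ _ _ be0 e1' e2') []|//] :=
  H da db dc U V W _ k ca cb cc U0 V0 W0 k0 ek s0.
- by rewrite -eV -eU.
- by rewrite -eW -eU.
Qed.

Ltac classes_tac :=
  apply: trivial_classes_linear => da db dc U V W s k;
  case=> [->|->|[[->|->] ?]] [->|->|[[->|->] ?]] [->|->|[[->|->] ?]]
 //
    ? ? ? ? [->|->|->] ? ? ?; try (by right); try (right; exfalso; lia).
Lemma sqr_mod3 (x : int) :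
  (exists y, x = 3 * y) \/ (exists k, x ^+ 2 = 3 * k + 1).
Proof.
have : exists y, x = 3 * y \/ x = 3 * y + 1 \/ x = 3 * y + 2.
  exists (x %/ 3)%Z; have := divz_eq x 3; have := modz_ge0 x (isT : (3 : int) != 0).
  by have := ltz_pmod x (isT : (0 : int) < 3); lia.
case=> y [->|[->|->]]; [by left; exists y | right..].
  by exists (3 * y ^+ 2 + 2 * y); ring.
by exists (3 * y ^+ 2 + 4 * y + 1); ring.
Qed.

(** -1 is not a square modulo 3. *)
Lemma sum_sqr_dvd3 (p q t : int) : p ^+ 2 + q ^+ 2 = 3 * t ->
  (exists p', p = 3 * p') /\ (exists q', q = 3 * q').
Proof.
have [hp|[j ->]] := sqr_mod3 p; have [hq|[k ->]] := sqr_mod3 q => //; last by lia.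
  by case: hp => a -> e; exfalso; have : 3 * (t - 3 * a ^+ 2 - k) = 1; [lra | lia].
by case: hq => a -> e; exfalso; have : 3 * (t - 3 * a ^+ 2 - j) = 1; [lra | lia].
Qed.

Lemma sqr_dvd3 (p t : int) : p ^+ 2 = 3 * t -> exists p', p = 3 * p'.
Proof.
by move=> e; have [|//] := @sum_sqr_dvd3 p 0 t; rewrite expr0n addr0.
Qed.

Lemma descent3 (P : int -> Prop) :
  (forall x, P x -> exists2 y, x = 3 * y & P y) -> forall x, P x -> x = 0.
Proof.
move=> H x; have [N] := ubnP `|x|%N; elim: N x => // N IH x ltN /H[y xy Py].
by have := IH y _ Py; rewrite xy; lia.
Qed.

Lemma sum_sqr_eq6 (be : int) :
  (exists p r : int, p ^+ 2 + r ^+ 2 = 6 * be ^+ 2) -> be = 0.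
Proof.
move: be; apply: descent3 => be [p [r e]].
have [|[a pa] [b rb]] := @sum_sqr_dvd3 p r (2 * be ^+ 2); first lra.
rewrite pa rb in e.
have [|c bc] := @sqr_dvd3 be (be ^+ 2 - a ^+ 2 - b ^+ 2); first lra.
by exists c => //; exists a, b; rewrite bc in e; lra.
Qed.

(** The first equation alone has the solution [p = q = be = 1]. The second forces [p = 3 a], and
    then the first reads [q^2 + be^2 = 3 (be^2 - 3 a^2)], so that 3 divides [q] and [be] too. *)
Lemma sum_sqr_eq2_eq18 (be : int) :
  (exists p q r : int, p ^+ 2 + q ^+ 2 = 2 * be ^+ 2 /\ p ^+ 2 + r ^+ 2 = 18 * be ^+ 2) ->
  be = 0.
Proof.
move: be; apply: descent3 => be [p [q [r [e1 e2]]]].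
have [|[a pa] [b rb]] := @sum_sqr_dvd3 p r (6 * be ^+ 2); first lra.
rewrite pa rb in e1 e2.
have [|[c qc] [d bd]] := @sum_sqr_dvd3 q be (be ^+ 2 - 3 * a ^+ 2); first lra.
by exists d => //; exists a, c, b; rewrite qc bd in e1 e2; split; lra.
Qed.

Lemma trivial_classes_all :
  [/\ trivial_classes 1 4, trivial_classes (-1) (-4), trivial_classes 2 8,
      trivial_classes (-2) (-8) & trivial_classes 3 12] /\
  [/\ trivial_classes 1 9, trivial_classes (-1) (-9), trivial_classes 2 18,
      trivial_classes (-2) (-18) & trivial_classes 3 27] /\
  trivial_classes (-2) (-6) /\ trivial_classes 6 18.
Proof.
split; [split|split; [split|split]]; classes_tac.
all: left=> p q r be be0 e1 e2; case/eqP: be0.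
1, 2: by apply: sum_sqr_eq2_eq18; exists p, q, r; split; lra.
all: by apply: sum_sqr_eq6; exists p, r; lra.
Qed.

Lemma no_odd_solutions A B C E :
  let no m n := odd_solution m n A B C E -> B = 0 in
  [/\ no 1 4, no (-1) (-4), no 2 8, no (-2) (-8) & no 3 12] /\
  [/\ no 1 9, no (-1) (-9), no 2 18, no (-2) (-18) & no 3 27] /\
  no (-2) (-6) /\ no 6 18.
Proof.
have [[? ? ? ? ?] [[? ? ? ? ?] [? ?]]] := even_denominators.
have [[? ? ? ? ?] [[? ? ? ? ?] [? ?]]] := trivial_classes_all.
by split; [split|split; [split|split]]; apply: no_odd_solution.
Qed.

Lemma sqr_even (x t : int) : x ^+ 2 = 2 * t -> exists y, x = 2 * y.
Proof.
have [y [->|->]] := int_half x; first by exists y.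
by move=> e; case: (@double_neq1 (t - 2 * y ^+ 2 - 2 * y)); lra.
Qed.

(** Halving [A] and [B] as long as both are even leaves [A] odd, where the descent applies, or [A]
    even and [B] odd, which needs an argument of its own. *)
Lemma primitive_solution (m n : int) (Q : int -> int -> Prop) :
  (forall A, Q A 0) -> (forall A B, Q A B -> Q (2 * A) (2 * B)) ->
  (forall A B C E, odd_solution m n A B C E -> Q A B) ->
  (forall A b C E, C ^+ 2 = (2 * A) ^+ 2 + m * (2 * b + 1) ^+ 2 ->
    E ^+ 2 = (2 * A) ^+ 2 + n * (2 * b + 1) ^+ 2 -> Q (2 * A) (2 * b + 1)) ->
  forall A B C E, C ^+ 2 = A ^+ 2 + m * B ^+ 2 -> E ^+ 2 = A ^+ 2 + n * B ^+ 2 -> Q A B.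
Proof.
move=> Q0 Q2 Hodd Heven A B; have [N] := ubnP `|B|%N; elim: N A B => // N IH A B ltN C E hC hE.
have [->|B0] := eqVneq B 0; first exact: Q0.
have [a [Aa|Aa]] := int_half A; last by apply: (Hodd A B C E); split=> //; exists a.
have [b [Bb|Bb]] := int_half B; last by rewrite Aa Bb; apply: (Heven _ _ C E); rewrite -?Aa -?Bb.
rewrite Aa Bb in hC hE *; apply: Q2.
have [|C' eC] := @sqr_even C (2 * a ^+ 2 + 2 * m * b ^+ 2); first by rewrite hC; ring.
have [|E' eE] := @sqr_even E (2 * a ^+ 2 + 2 * n * b ^+ 2); first by rewrite hE; ring.
have b0 : b != 0 by apply: contraNneq B0 => b0; rewrite Bb b0 mulr0.
apply: (IH a b _ C' E'); rewrite ?eC ?eE in hC hE; [|lra|lra].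
by apply: leq_trans (ltN : (_ <= N)%N); rewrite Bb abszM ltn_Pmull // absz_gt0.
Qed.

Lemma odd_numerator_linear (m n : int) :
  (forall a b s t h i j k : int, sqr_form a i -> sqr_form s j -> sqr_form t k ->
    a = 2 * h -> s = a + m * (8 * b + 1) -> t = a + n * (8 * b + 1) -> False) ->
  forall A b C E, C ^+ 2 = (2 * A) ^+ 2 + m * (2 * b + 1) ^+ 2 ->
    E ^+ 2 = (2 * A) ^+ 2 + n * (2 * b + 1) ^+ 2 -> False.
Proof.
move=> H A b C E; have [k _ ->] := odd_sqr b => hC hE.
have [i _ ha] := sqr_mod32 (2 * A); have [j _ hs] := sqr_mod32 C.
have [l _ ht] := sqr_mod32 E.
by apply: (H _ k _ _ (2 * A ^+ 2) i j l ha hs ht); rewrite ?hC ?hE //; ring.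
Qed.

Definition only_trivial (m n : int) (Q : int -> int -> Prop) :=
  forall A B C E, C ^+ 2 = A ^+ 2 + m * B ^+ 2 -> E ^+ 2 = A ^+ 2 + n * B ^+ 2 -> Q A B.

Lemma only_trivial_twists (Q := fun _ B => B = 0) :
  [/\ only_trivial (-1) (-4) Q, only_trivial 2 8 Q, only_trivial (-2) (-8) Q
     & only_trivial 3 12 Q] /\
  [/\ only_trivial (-1) (-9) Q, only_trivial 2 18 Q, only_trivial (-2) (-18) Q
     & only_trivial 3 27 Q] /\
  only_trivial (-2) (-6) Q /\ only_trivial 6 18 Q.
Proof.
have Q0 A : Q A 0 by [].
have Q2 A B : Q A B -> Q (2 * A) (2 * B) by rewrite /Q => ->; rewrite mulr0.
split; [split|split; [split|split]]; apply: (primitive_solution Q0 Q2);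
  try by move=> A B C E; have := no_odd_solutions A B C E; case=> [[? ? ? ? ?] [[? ? ? ? ?] [? ?]]].
(* For the twists, [A] even and [B] odd is already impossible by the residues of squares. *)
all: move=> A b C E hC hE; exfalso; move: A b C E hC hE; apply: odd_numerator_linear.
all: by move=> a b s t h i j k [->|->|->] [->|->|->] [->|->|->]; lia.
Qed.

(* An odd [B] is reached from an even one by the translation [w |-> n / w] by the
   point of order two [(0, 0)]. *)
Lemma only_trivial_untwisted (Q := fun A B => A = 0 \/ B = 0) :
  only_trivial 1 4 Q /\ only_trivial 1 9 Q.
Proof.
have Q0 A : Q A 0 by right.
have Q2 A B : Q A B -> Q (2 * A) (2 * B).
  by case=> ->; [left|right]; rewrite mulr0.
split; apply: (primitive_solution Q0 Q2).
- by move=> A B C E; case: (no_odd_solutions A B C E) => [[H _ _ _ _] _] /H; right.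
- move=> A b C E hC hE; left.
  have [|E' eE] := @sqr_even E (2 * A ^+ 2 + 2 * (2 * b + 1) ^+ 2); first by rewrite hE; ring.
  rewrite eE in hE.
  case: (no_odd_solutions (2 * b + 1) A E' C) => [[H _ _ _ _] _].
  by rewrite H ?mulr0 //; split; [exists b | lra | lra].
- by move=> A B C E; case: (no_odd_solutions A B C E) => [_ [[H _ _ _ _] _]] /H; right.
move=> A b C E hC hE; left.
case: (no_odd_solutions (3 * (2 * b + 1)) (2 * A) E (3 * C)) => [_ [[H _ _ _ _] _]].
by apply: H; split; [exists (3 * b + 1); ring | lra | lra].
Qed.

(** * Rational points and quadratic twists *)

Lemma rat_common_denominator (x y z : rat) :
  exists A C E B : int,
  [/\ B != 0, x = A%:~R / B%:~R, y = C%:~R / B%:~R & z = E%:~R / B%:~R].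
Proof.
exists (numq x * (denq y * denq z)), (numq y * (denq x * denq z)),
  (numq z * (denq x * denq y)), (denq x * denq y * denq z).
have d0 (q : rat) : (denq q)%:~R != 0 :> rat by rewrite intr_eq0 denq_neq0.
split; first by rewrite !mulf_neq0 ?denq_neq0.
- by rewrite !rmorphM /= -{1}[x]divq_num_den; field; rewrite !d0.
- by rewrite !rmorphM /= -{1}[y]divq_num_den; field; rewrite !d0.
- by rewrite !rmorphM /= -{1}[z]divq_num_den; field; rewrite !d0.
Qed.

Lemma only_trivial_rat (m n : int) Q : only_trivial m n Q ->
  forall x y z : rat, y ^+ 2 = x ^+ 2 + m%:~R -> z ^+ 2 = x ^+ 2 + n%:~R ->
  exists A B : int, [/\ B != 0, x = A%:~R / B%:~R & Q A B].
Proof.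
move=> H x y z; have [A [C [E [B [B0 -> -> ->]]]]] := rat_common_denominator x y z.
have b0 : B%:~R != 0 :> rat by rewrite intr_eq0.
have clear (k X : int) : (X%:~R / B%:~R) ^+ 2 = (A%:~R / B%:~R) ^+ 2 + k%:~R :> rat ->
    X ^+ 2 = A ^+ 2 + k * B ^+ 2.
  move=> e; apply: (@intr_inj rat); rewrite rmorphD rmorphM !rmorphXn /=.
  have {1}-> : X%:~R = X%:~R / B%:~R * B%:~R :> rat by rewrite divfK.
  by rewrite exprMn e; field.
by move=> /clear hC /clear hE; exists A, B; split=> //; apply: (H A B C E).
Qed.

(* [d x^2], [d x^2 + m] and [d x^2 + n] lie on the twist by [d] of the curve of
   triples of squares [w], [w + m], [w + n]. *)
Definition no_twist (d m n : int) := forall x y z : rat,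
  d%:~R * y ^+ 2 = d%:~R * x ^+ 2 + m%:~R -> d%:~R * z ^+ 2 = d%:~R * x ^+ 2 + n%:~R -> False.

(** Multiplied by [d], the terms [d x^2], [d y^2], [d z^2] become the squares of [d x], [d y],
    [d z], with differences [d m] and [d n]. *)
Lemma no_twistP (d m n : int) :
  only_trivial (d * m) (d * n) (fun _ B => B = 0) -> no_twist d m n.
Proof.
move=> H x y z hy hz.
have [||A [B [/eqP B0 _ //]]] := @only_trivial_rat _ _ _ H (d%:~R * x) (d%:~R * y) (d%:~R * z).
  rewrite rmorphM /=; have -> : (d%:~R * y) ^+ 2 = d%:~R * (d%:~R * y ^+ 2) by ring.
  by rewrite hy; ring.
rewrite rmorphM /=; have -> : (d%:~R * z) ^+ 2 = d%:~R * (d%:~R * z ^+ 2) by ring.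
by rewrite hz; ring.
Qed.

Definition discriminants : seq int := [:: -1; 3; 2; -2].

Lemma no_twist14 d : d \in discriminants -> no_twist d 1 4.
Proof.
have [[? ? ? ?] _] := only_trivial_twists.
by rewrite !inE => /or4P[] /eqP->; apply: no_twistP.
Qed.

Lemma no_twist19 d : d \in discriminants -> no_twist d 1 9.
Proof.
have [_ [[? ? ? ?] _]] := only_trivial_twists.
by rewrite !inE => /or4P[] /eqP->; apply: no_twistP.
Qed.

Lemma no_twist26 d : d = -1 \/ d = 3 -> no_twist d 2 6.
Proof.
by have [_ [_ [? ?]]] := only_trivial_twists; case=> ->; apply: no_twistP.
Qed.

Lemma only_zero14 (x y z : rat) : y ^+ 2 = x ^+ 2 + 1 -> z ^+ 2 = x ^+ 2 + 4 -> x = 0.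
Proof.
move=> hy hz; have [H _] := only_trivial_untwisted.
have [//|//|A [B [/eqP B0 -> []// ->]]] := @only_trivial_rat _ _ _ H x y z.
by rewrite mul0r.
Qed.

Lemma only_zero19 (x y z : rat) : y ^+ 2 = x ^+ 2 + 1 -> z ^+ 2 = x ^+ 2 + 9 -> x = 0.
Proof.
move=> hy hz; have [_ H] := only_trivial_untwisted.
have [//|//|A [B [/eqP B0 -> []// ->]]] := @only_trivial_rat _ _ _ H x y z.
by rewrite mul0r.
Qed.

(** * Conjugation and addition of points over a quadratic extension *)

Lemma natK_neq0 (K : fieldExtType rat) (n : nat) : n.+1%:R != 0 :> K.
Proof.
have -> : n.+1%:R = (n.+1%:R : rat) *: (1 : K) by rewrite scaler_nat.
by rewrite scaler_eq0 oner_eq0 orbF pnatr_eq0.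
Qed.

Lemma sqr_eqP (K : fieldExtType rat) (x y : K) : x ^+ 2 = y ^+ 2 -> x = y \/ x = - y.
Proof. by move/eqP; rewrite eqf_sqr => /orP[] /eqP; [left | right]. Qed.

Ltac mem1 := match goal with
 | h : is_true (?x \in ?F) |- is_true (?x \in ?F) => exact h
 | |- is_true (0 \in _) => apply: rpred0
 | |- is_true (1 \in _) => apply: rpred1
 | |- is_true (_%:R \in _) => apply: rpred_nat
 | |- is_true (_%:~R \in _) => apply: rpred_int
 | |- is_true (_ + _ \in _) => apply: rpredD
 | |- is_true (- _ \in _) => rewrite rpredN
 | |- is_true (_ * _ \in _) => apply: rpredM
 | |- is_true (_ ^+ _ \in _) => apply: rpredX
 | |- is_true (_^-1 \in _) => rewrite rpredV
 end.
Ltac mem := repeat mem1.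

(* [y] is the image of [x = a + b t] under the involution [t |-> - t] of [F(t)/F]. *)
Definition conjugate (K : fieldExtType rat) (F : {subfield K}) (t x y : K) : Prop :=
  exists a b : K, [/\ a \in F, b \in F, x = a + b * t & y = a - b * t].

Definition sqrt_over (K : fieldExtType rat) (F : {subfield K}) (t : K) : Prop :=
  t ^+ 2 \in F /\ t \notin F.

Lemma conj_mem (K : fieldExtType rat) (F : {subfield K}) t x : x \in F -> conjugate F t x x.
Proof. by move=> xF; exists x, 0; split; rewrite ?rpred0 //; ring. Qed.

Lemma conjC (K : fieldExtType rat) (F : {subfield K}) t x y :
  conjugate F t x y -> conjugate F t y x.
Proof. by by move=> [a [b [aF bF -> ->]]]; exists a, (- b); split; [mem | mem | ring | ring]. Qed.

Lemma conjD (K : fieldExtType rat) (F : {subfield K}) t x y x' y' :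
  conjugate F t x x' -> conjugate F t y y' -> conjugate F t (x + y) (x' + y').
Proof.
move=> [a [b [aF bF -> ->]]] [c [d [cF dF -> ->]]].
by exists (a + c), (b + d); split; [mem | mem | ring | ring].
Qed.

Lemma conjN (K : fieldExtType rat) (F : {subfield K}) t x x' :
  conjugate F t x x' -> conjugate F t (- x) (- x').
Proof.
by move=> [a [b [aF bF -> ->]]]; exists (- a), (- b); split; [mem | mem | ring | ring].
Qed.

Lemma conjM (K : fieldExtType rat) (F : {subfield K}) t x y x' y' : t ^+ 2 \in F ->
  conjugate F t x x' -> conjugate F t y y' -> conjugate F t (x * y) (x' * y').
Proof.
move=> tF [a [b [aF bF -> ->]]] [c [d [cF dF -> ->]]].
by exists (a * c + b * d * t ^+ 2), (a * d + b * c); split; [mem | mem | ring | ring].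
Qed.

Lemma conjX (K : fieldExtType rat) (F : {subfield K}) t x x' n : t ^+ 2 \in F ->
  conjugate F t x x' -> conjugate F t (x ^+ n) (x' ^+ n).
Proof.
move=> tF c; elim: n => [|n IH]; first by rewrite !expr0; apply/conj_mem/rpred1.
by rewrite !exprS; apply: conjM.
Qed.

Lemma conj_fixed (K : fieldExtType rat) (F : {subfield K}) t x :
  conjugate F t x x -> x \in F.
Proof.
move=> [a [b [aF bF e1 e2]]]; suff : b * t = 0 by move=> e; rewrite e1 e addr0.
have e : 2 * (b * t) = 0 by rewrite -(subrr x) {1}e1 e2; ring.
by move/eqP: e; rewrite mulf_eq0 (negPf (natK_neq0 K 1)) => /eqP.
Qed.

Lemma conj_anti (K : fieldExtType rat) (F : {subfield K}) t x :
  conjugate F t x (- x) -> exists2 b, b \in F & x = b * t.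
Proof.
move=> [a [b [aF bF e1 e2]]]; exists b => //.
have e : 2 * a = 0 by rewrite -(subrr x) {1}e1 e2; ring.
by move/eqP: e; rewrite mulf_eq0 (negPf (natK_neq0 K 1)) e1 => /eqP->; rewrite add0r.
Qed.

(** Two representations [a + b t] with different [b] would put [t] into [F]; thus the relation is a
    partial function. *)
Lemma conj_uniq (K : fieldExtType rat) (F : {subfield K}) t x y z : t \notin F ->
  conjugate F t x y -> conjugate F t x z -> y = z.
Proof.
move=> tF [a [b [aF bF -> ->]]] [c [d [cF dF e ->]]].
suff bd : b = d by move: e; rewrite bd => /addIr ->.
apply/eqP; rewrite -subr_eq0; apply: contraNT tF => bd0.
have -> : t = (c - a) / (b - d).
  by apply: (mulIf bd0); rewrite divfK //; apply/eqP; rewrite -subr_eq0; apply/eqP;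
  rewrite -(subrr (a + b * t)) {2}e; ring.
by mem.
Qed.

Lemma conj_uniqF (K : fieldExtType rat) (F : {subfield K}) t x y : t \notin F ->
  conjugate F t x y -> x \in F -> y = x.
Proof. by move=> tF c xF; apply: (conj_uniq tF c); apply: conj_mem. Qed.

Lemma conj_sqr (K : fieldExtType rat) (F : {subfield K}) t x y : sqrt_over F t ->
  conjugate F t x y -> x ^+ 2 \in F -> y = x \/ y = - x.
Proof.
move=> [t2F tF] c xF; apply: sqr_eqP; apply: (conj_uniqF tF _ xF); exact: conjX.
Qed.

Lemma sqrt_over_neq0 (K : fieldExtType rat) (F : {subfield K}) t :
  sqrt_over F t -> t != 0.
Proof. by case=> _; apply: contraNneq => ->; rewrite rpred0. Qed.

(* On the curve of triples [s0, s1, s2] (in the role of ns, cs, ds) the difference of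
   two points has the coordinates [(s0 s1' s2' + s0' s1 s2) / (s0'^2 - s0^2)], etc.;
   for conjugate points these are rational multiples of [t]. *)
Lemma addition_twist (K : fieldExtType rat) (F : {subfield K}) (t m n s0 s1 s2 s0' s1' s2' : K) :
  sqrt_over F t -> m \in F -> n \in F ->
  (forall x y z, x \in F -> y \in F -> z \in F ->
    t ^+ 2 * y ^+ 2 = t ^+ 2 * x ^+ 2 + m -> t ^+ 2 * z ^+ 2 = t ^+ 2 * x ^+ 2 + n -> False) ->
  conjugate F t s0 s0' -> conjugate F t s1 s1' -> conjugate F t s2 s2' ->
  s1 ^+ 2 = s0 ^+ 2 + m -> s2 ^+ 2 = s0 ^+ 2 + n ->
  s0 ^+ 2 \in F /\ s0 * s1 * s2 \in F.
Proof.
move=> st mF nF NT c0 c1 c2 h1 h2; have [t2F tF] := st; have t0 := sqrt_over_neq0 st.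
have c00 := conjX 2 t2F c0.
have h1' : s1' ^+ 2 = s0' ^+ 2 + m.
  by apply: (conj_uniq tF (conjX 2 t2F c1)); rewrite h1; apply: conjD => //; apply: conj_mem.
have h2' : s2' ^+ 2 = s0' ^+ 2 + n.
  by apply: (conj_uniq tF (conjX 2 t2F c2)); rewrite h2; apply: conjD => //; apply: conj_mem.
(* If the point and its conjugate have different abscissas, their difference is a point of the
   twist, against [NT]. *)
have [ww|ww] := eqVneq (s0' ^+ 2) (s0 ^+ 2); last first.
  exfalso; have [b bF eb] : exists2 b, b \in F & s0' ^+ 2 - s0 ^+ 2 = b * t.
    by apply: conj_anti; rewrite opprB; apply: conjD; [apply: conjC | apply: conjN].
  have b0 : b != 0 by apply: contraNneq ww => b0; rewrite -subr_eq0 eb b0 mul0r.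
  have symF x y z x' y' z' : conjugate F t x x' -> conjugate F t y y' -> conjugate F t z z' ->
      x * y' * z' + x' * y * z \in F.
    move=> cx cy cz; apply: (@conj_fixed _ _ t).
    have c : conjugate F t (x * y' * z') (x' * y * z).
      by apply: conjM => //; [apply: conjM => //|]; apply: conjC.
    by have := conjD c (conjC c); rewrite [x' * y * z + _]addrC.
  have N0F := symF _ _ _ _ _ _ c0 c1 c2; have N1F := symF _ _ _ _ _ _ c1 c0 c2.
  have N2F := symF _ _ _ _ _ _ c2 c0 c1.
  set N0 := (X in X \in F) in N0F; set N1 := (X in X \in F) in N1F.
  set N2 := (X in X \in F) in N2F.
  have e1 : N1 ^+ 2 = N0 ^+ 2 + m * (s0' ^+ 2 - s0 ^+ 2) ^+ 2.
    have -> : N1 ^+ 2 = s1 ^+ 2 * s0' ^+ 2 * s2' ^+ 2 + s1' ^+ 2 * s0 ^+ 2 * s2 ^+ 2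
      + 2 * (s0 * s1 * s2 * s0' * s1' * s2') by rewrite /N1; ring.
    have -> : N0 ^+ 2 = s0 ^+ 2 * s1' ^+ 2 * s2' ^+ 2 + s0' ^+ 2 * s1 ^+ 2 * s2 ^+ 2
      + 2 * (s0 * s1 * s2 * s0' * s1' * s2') by rewrite /N0; ring.
    by rewrite h1 h2 h1' h2'; ring.
  have e2 : N2 ^+ 2 = N0 ^+ 2 + n * (s0' ^+ 2 - s0 ^+ 2) ^+ 2.
    have -> : N2 ^+ 2 = s2 ^+ 2 * s0' ^+ 2 * s1' ^+ 2 + s2' ^+ 2 * s0 ^+ 2 * s1 ^+ 2
      + 2 * (s0 * s1 * s2 * s0' * s1' * s2') by rewrite /N2; ring.
    have -> : N0 ^+ 2 = s0 ^+ 2 * s1' ^+ 2 * s2' ^+ 2 + s0' ^+ 2 * s1 ^+ 2 * s2 ^+ 2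
      + 2 * (s0 * s1 * s2 * s0' * s1' * s2') by rewrite /N0; ring.
    by rewrite h1 h2 h1' h2'; ring.
  rewrite eb in e1 e2.
  apply: (NT (N0 / (b * t ^+ 2)) (N1 / (b * t ^+ 2)) (N2 / (b * t ^+ 2))); try by mem.
    have -> : t ^+ 2 * (N1 / (b * t ^+ 2)) ^+ 2 = N1 ^+ 2 / (b * t) ^+ 2.
      by field; rewrite b0 t0.
    by rewrite e1; field; rewrite b0 t0.
  have -> : t ^+ 2 * (N2 / (b * t ^+ 2)) ^+ 2 = N2 ^+ 2 / (b * t) ^+ 2.
    by field; rewrite b0 t0.
  by rewrite e2; field; rewrite b0 t0.
have wF : s0 ^+ 2 \in F by apply: (@conj_fixed _ _ t); rewrite -{2}ww.
split=> //; set v := s0 * s1 * s2.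
have v2 : v ^+ 2 = s0 ^+ 2 * (s0 ^+ 2 + m) * (s0 ^+ 2 + n) by rewrite -h1 -h2 /v; ring.
have cv : conjugate F t v (s0' * s1' * s2') by do 2 apply: conjM => //.
have [|e|e] := conj_sqr st cv; first by rewrite v2; mem.
  by apply: (@conj_fixed _ _ t); rewrite -{2}e.
have [->|v0] := eqVneq v 0; first by rewrite rpred0.
(* Conjugation negates the point, so [v = b t] and [(w, v)] comes from the twist; its double, by the
   doubling formulas, contradicts [NT]. *)
rewrite e in cv; have [b bF vb] := conj_anti cv.
have b0 : b != 0 by apply: contraNneq v0 => b0; rewrite vb b0 mul0r.
exfalso; set w := s0 ^+ 2 in wF v2.
have n2 := natK_neq0 K 1.
apply: (NT ((w ^+ 2 - m * n) / (2 * b * t ^+ 2))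
  (((w + m) ^+ 2 + m * (n - m)) / (2 * b * t ^+ 2))
  (((w + n) ^+ 2 - n * (n - m)) / (2 * b * t ^+ 2))).
- by mem.
- by mem.
- by mem.
- apply/eqP; rewrite -subr_eq0; apply/eqP.
  transitivity ((((w + m) ^+ 2 + m * (n - m)) ^+ 2 - (w ^+ 2 - m * n) ^+ 2 - 4 * m * v ^+ 2)
    / (2 * b * t) ^+ 2); last by rewrite v2 -[RHS](mul0r (((2 * b * t) ^+ 2)^-1)); congr (_ / _); ring.
  by rewrite vb; field; rewrite n2 b0 t0.
apply/eqP; rewrite -subr_eq0; apply/eqP.
transitivity ((((w + n) ^+ 2 - n * (n - m)) ^+ 2 - (w ^+ 2 - m * n) ^+ 2 - 4 * n * v ^+ 2)
  / (2 * b * t) ^+ 2); last by rewrite v2 -[RHS](mul0r (((2 * b * t) ^+ 2)^-1)); congr (_ / _); ring.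
by rewrite vb; field; rewrite n2 b0 t0.
Qed.

(* The sum of a point and its conjugate is defined over [F]. *)
Lemma addition_trace (K : fieldExtType rat) (F : {subfield K}) (t m n s0 s1 s2 s0' s1' s2' : K) :
  sqrt_over F t -> m \in F -> n \in F ->
  conjugate F t s0 s0' -> conjugate F t s1 s1' -> conjugate F t s2 s2' ->
  s1 ^+ 2 = s0 ^+ 2 + m -> s2 ^+ 2 = s0 ^+ 2 + n -> s0 ^+ 2 != s0' ^+ 2 ->
  exists x y z, [/\ x \in F, y \in F & z \in F] /\
    [/\ y ^+ 2 = x ^+ 2 + m, z ^+ 2 = x ^+ 2 + n
      & x * (s0' ^+ 2 - s0 ^+ 2) = s0 * s1' * s2' - s0' * s1 * s2].
Proof.
move=> st mF nF c0 c1 c2 h1 h2 ww; have [t2F tF] := st; have t0 := sqrt_over_neq0 st.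
have c00 := conjX 2 t2F c0.
have h1' : s1' ^+ 2 = s0' ^+ 2 + m.
  by apply: (conj_uniq tF (conjX 2 t2F c1)); rewrite h1; apply: conjD => //; apply: conj_mem.
have h2' : s2' ^+ 2 = s0' ^+ 2 + n.
  by apply: (conj_uniq tF (conjX 2 t2F c2)); rewrite h2; apply: conjD => //; apply: conj_mem.
have [b bF eb] : exists2 b, b \in F & s0' ^+ 2 - s0 ^+ 2 = b * t.
  by apply: conj_anti; rewrite opprB; apply: conjD; [apply: conjC | apply: conjN].
have b0 : b != 0 by apply: contraNneq ww => b0; rewrite eq_sym -subr_eq0 eb b0 mul0r.
(* These numerators change sign under conjugation, and so does [s0'^2 - s0^2 = b t]; hence the
   quotients lie in [F]. *)
have antiF x y z x' y' z' : conjugate F t x x' -> conjugate F t y y' -> conjugate F t z z' ->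
    exists2 a, a \in F & x * y' * z' - x' * y * z = a * t.
  move=> cx cy cz; apply: conj_anti; rewrite opprB; apply: conjD.
    by apply: conjM => //; [apply: conjM => //|]; apply: conjC.
  by apply: conjN; apply: conjM => //; apply: conjM => //; apply: conjC.
have [a0 a0F N0] := antiF _ _ _ _ _ _ c0 c1 c2.
have [a1 a1F N1] := antiF _ _ _ _ _ _ c1 c0 c2.
have [a2 a2F N2] := antiF _ _ _ _ _ _ c2 c0 c1.
have e0 : (a0 * t) ^+ 2 = s0 ^+ 2 * s1' ^+ 2 * s2' ^+ 2 + s0' ^+ 2 * s1 ^+ 2 * s2 ^+ 2
      - 2 * (s0 * s1 * s2 * s0' * s1' * s2') by rewrite -N0; ring.
have e1 : (a1 * t) ^+ 2 = (a0 * t) ^+ 2 + m * (b * t) ^+ 2.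
  have -> : (a1 * t) ^+ 2 = s1 ^+ 2 * s0' ^+ 2 * s2' ^+ 2 + s1' ^+ 2 * s0 ^+ 2 * s2 ^+ 2
      - 2 * (s0 * s1 * s2 * s0' * s1' * s2') by rewrite -N1; ring.
  by rewrite e0 -eb h1 h2 h1' h2'; ring.
have e2 : (a2 * t) ^+ 2 = (a0 * t) ^+ 2 + n * (b * t) ^+ 2.
  have -> : (a2 * t) ^+ 2 = s2 ^+ 2 * s0' ^+ 2 * s1' ^+ 2 + s2' ^+ 2 * s0 ^+ 2 * s1 ^+ 2
      - 2 * (s0 * s1 * s2 * s0' * s1' * s2') by rewrite -N2; ring.
  by rewrite e0 -eb h1 h2 h1' h2'; ring.
exists (a0 / b), (a1 / b), (a2 / b); split; first by split; mem.
split; last by rewrite N0 eb; field.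
- have -> : (a1 / b) ^+ 2 = (a1 * t) ^+ 2 / (b * t) ^+ 2 by field; rewrite b0 t0.
  by rewrite e1; field; rewrite b0 t0.
have -> : (a2 / b) ^+ 2 = (a2 * t) ^+ 2 / (b * t) ^+ 2 by field; rewrite b0 t0.
by rewrite e2; field; rewrite b0 t0.
Qed.

(** The double of [(w, v)] has abscissa the square of [(w^2 - m n) / (2 v)]. The other two witnesses
    are the same formula with the origin moved to [-m] and to [-n], where [m, n] become [-m, n - m]
    and [-n, m - n]. *)
Lemma doubling (K : fieldExtType rat) (F : {subfield K}) (m n w v : K) :
  m \in F -> n \in F -> w \in F -> v \in F -> v != 0 ->
  v ^+ 2 = w * (w + m) * (w + n) ->
  exists x y z, [/\ x \in F, y \in F & z \in F] /\
    [/\ y ^+ 2 = x ^+ 2 + m, z ^+ 2 = x ^+ 2 + n & 2 * v * x = w ^+ 2 - m * n].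
Proof.
move=> mF nF wF vF v0 v2; have n2 := natK_neq0 K 1.
exists ((w ^+ 2 - m * n) / (2 * v)), (((w + m) ^+ 2 + m * (n - m)) / (2 * v)),
  (((w + n) ^+ 2 - n * (n - m)) / (2 * v)); split; first by split; mem.
have k0 : (2 * v) ^+ 2 != 0 by rewrite expf_neq0 // mulf_neq0.
split; last by rewrite mulrC divfK // mulf_neq0.
- apply: (mulIf k0); rewrite [RHS](_ : _ = (w ^+ 2 - m * n) ^+ 2 + 4 * m * v ^+ 2).
    by rewrite v2; field; rewrite n2 v0.
  by field; rewrite n2 v0.
apply: (mulIf k0); rewrite [RHS](_ : _ = (w ^+ 2 - m * n) ^+ 2 + 4 * n * v ^+ 2).
  by rewrite v2; field; rewrite n2 v0.
by field; rewrite n2 v0.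
Qed.

(** * Triples of squares over the fields Q(sqrt d) *)

Lemma adjoin_sqrtP (K : fieldExtType rat) (F : {subfield K}) (t x : K) :
  t ^+ 2 \in F -> x \in <<F; t>>%VS ->
  exists a b : K, [/\ a \in F, b \in F & x = a + b * t].
Proof.
move=> tF /Fadjoin_polyP[p /polyOverP pF ->]; rewrite horner_coef.
pose good (z : K) := exists a b : K, [/\ a \in F, b \in F & z = a + b * t].
have goodX i : good (t ^+ i).
  elim: i => [|i [a [b [aF bF e]]]]; first by exists 1, 0; split; [mem | mem | ring].
  by exists (b * t ^+ 2), a; split; [mem | mem | rewrite [LHS]exprS e; ring].
apply: (big_ind good) => [|x1 x2|i _].
- by exists 0, 0; split; [mem | mem | ring].
- move=> [a [b [aF bF ->]]] [c [d [cF dF ->]]].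
  by exists (a + c), (b + d); split; [mem | mem | ring].
have [a [b [aF bF ->]]] := goodX i; have cF := pF i.
by exists (p`_i * a), (p`_i * b); split; [mem | mem | ring].
Qed.

Lemma conj_exists (K : fieldExtType rat) (F : {subfield K}) (t x : K) :
  t ^+ 2 \in F -> x \in <<F; t>>%VS -> exists y, conjugate F t x y.
Proof.
by move=> tF /(adjoin_sqrtP tF)[a [b [aF bF e]]]; exists (a - b * t), a, b.
Qed.

Definition of_rat (K : fieldExtType rat) (q : rat) : K := q%:A.
HB.instance Definition _ (K : fieldExtType rat) :=
  GRing.RMorphism.copy (of_rat K) (in_alg K).

Lemma mem_ratP (K : fieldExtType rat) (x : K) :
  x \in (1%AS : {subfield K}) -> exists q : rat, x = of_rat K q.
Proof. by case/vlineP=> q ->; exists q. Qed.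

Lemma of_rat_inj (K : fieldExtType rat) : injective (of_rat K).
Proof. exact: fmorph_inj. Qed.

Lemma rat_sqr_int (q : rat) (z : int) : q ^+ 2 = z%:~R -> exists b : int, b ^+ 2 = z.
Proof.
move=> e; have dq0 : (denq q)%:~R != 0 :> rat by rewrite intr_eq0 denq_neq0.
have e' : numq q ^+ 2 = z * denq q ^+ 2.
  apply: (@intr_inj rat); rewrite rmorphXn [RHS]rmorphM [in RHS]rmorphXn /=.
  have <- : q * (denq q)%:~R = (numq q)%:~R by rewrite -{1}[q]divq_num_den divfK.
  by rewrite -e; ring.
have d1 : (denq q %| 1)%Z.
  have cop : coprimez (denq q) (numq q ^+ 2).
    by rewrite coprimezXr // coprimez_sym; apply: coprime_num_den.
  by rewrite -(Gauss_dvdzr _ cop) mulr1 e' expr2 mulrA dvdz_mull.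
by exists (numq q); move: d1; rewrite dvdz1 => /eqP d1; rewrite e'; have := denq_gt0 q; lia.
Qed.

(** The bound makes this decidable by computation: the list holds all squares up to 50, and negative
    integers pass. *)
Definition small_nonsquare (z : int) :=
  (z <= 50) && (z \notin [:: 0; 1; 4; 9; 16; 25; 36; 49]).

Lemma small_nonsquareP (b z : int) : b ^+ 2 = z -> small_nonsquare z -> False.
Proof.
move=> <-; have -> : b ^+ 2 = (`|b| * `|b|)%N%:Z by lia.
move: `|b|%N => k /andP[k50]; have : (k < 8)%N by nia.
by case: k k50 => [|[|[|[|[|[|[|[|]]]]]]]].
Qed.

Lemma discriminantP d : d \in discriminants ->
  [/\ small_nonsquare d, d <> 0 & d <= 50].
Proof. by rewrite !inE => /or4P[] /eqP->. Qed.

Lemma sqrt_disc (K : fieldExtType rat) (d : int) (r : K) : d \in discriminants ->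
  r ^+ 2 = d%:~R -> sqrt_over 1%AS r.
Proof.
move=> hd hr; split; first by rewrite hr; mem.
apply/negP=> /mem_ratP[q rq]; have [nsd _ _] := discriminantP hd.
suff : q ^+ 2 = d%:~R by case/rat_sqr_int=> b /small_nonsquareP; apply.
by apply: (@of_rat_inj K); rewrite rmorphXn rmorph_int -hr rq.
Qed.

(** An element of Q(r) with rational square is [q] or [q r] with [q] rational, so [z] or
    [z d = (q d)^2] would be a rational square. *)
Lemma int_sqr_in_disc_field (K : fieldExtType rat) (d : int) (r x : K) (z : int) :
  d \in discriminants -> r ^+ 2 = d%:~R -> x \in <<1; r>>%VS -> x ^+ 2 = z%:~R ->
  small_nonsquare z -> small_nonsquare (z * d) -> False.
Proof.
move=> hd hr xk xz nz nzd; have sr := sqrt_disc hd hr.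
have key (q : rat) (y : int) : (of_rat K q) ^+ 2 = y%:~R -> small_nonsquare y -> False.
  move=> e; suff : q ^+ 2 = y%:~R by case/rat_sqr_int=> b /small_nonsquareP.
  by apply: (@of_rat_inj K); rewrite rmorphXn rmorph_int.
have [r2 r1] := sr; have [x' cx] := @conj_exists K 1%AS r x r2 xk.
case: (conj_sqr sr cx); first by rewrite xz; mem.
  move=> e; rewrite e in cx; case/mem_ratP: (conj_fixed cx) => q xq.
  by apply: (key q z) => //; rewrite -xq.
move=> e; rewrite e in cx; have [b /mem_ratP[q bq] xb] := conj_anti cx.
apply: (key (q * d%:~R) (z * d)) => //.
rewrite [of_rat K _]rmorphM rmorph_int /= -bq [RHS]rmorphM /= -xz xb -hr; ring.
Qed.

Lemma no_twist_alg (K : fieldExtType rat) (d m n : int) (r : K) : r ^+ 2 = d%:~R ->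
  no_twist d m n ->
  forall x y z : K, x \in (1%AS : {subfield K}) -> y \in (1%AS : {subfield K}) ->
    z \in (1%AS : {subfield K}) ->
    r ^+ 2 * y ^+ 2 = r ^+ 2 * x ^+ 2 + m%:~R ->
    r ^+ 2 * z ^+ 2 = r ^+ 2 * x ^+ 2 + n%:~R -> False.
Proof.
move=> -> NT x y z /mem_ratP[a ->] /mem_ratP[b ->] /mem_ratP[c ->] h1 h2.
apply: (NT a b c); apply: (@of_rat_inj K).
  by rewrite !(rmorphD, rmorphM, rmorphXn, rmorph_int).
by rewrite !(rmorphD, rmorphM, rmorphXn, rmorph_int).
Qed.

Lemma only_zero14_alg (K : fieldExtType rat) (x y z : K) :
  x \in (1%AS : {subfield K}) -> y \in (1%AS : {subfield K}) ->
  z \in (1%AS : {subfield K}) ->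
  y ^+ 2 = x ^+ 2 + 1 -> z ^+ 2 = x ^+ 2 + 4 -> x = 0.
Proof.
move=> /mem_ratP[a ->] /mem_ratP[b ->] /mem_ratP[c ->] h1 h2.
rewrite (@only_zero14 a b c) ?rmorph0 //; apply: (@of_rat_inj K).
  by rewrite rmorphD !rmorphXn rmorph1.
by rewrite rmorphD !rmorphXn rmorph_nat.
Qed.

Lemma only_zero19_alg (K : fieldExtType rat) (x y z : K) :
  x \in (1%AS : {subfield K}) -> y \in (1%AS : {subfield K}) ->
  z \in (1%AS : {subfield K}) ->
  y ^+ 2 = x ^+ 2 + 1 -> z ^+ 2 = x ^+ 2 + 9 -> x = 0.
Proof.
move=> /mem_ratP[a ->] /mem_ratP[b ->] /mem_ratP[c ->] h1 h2.
rewrite (@only_zero19 a b c) ?rmorph0 //; apply: (@of_rat_inj K).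
  by rewrite rmorphD !rmorphXn rmorph1.
by rewrite rmorphD !rmorphXn rmorph_nat.
Qed.

Lemma rational_sum_and_product (K : fieldExtType rat) (d m n : int) (r s0 s1 s2 : K) :
  d \in discriminants -> r ^+ 2 = d%:~R -> no_twist d m n ->
  s0 \in <<1; r>>%VS -> s1 \in <<1; r>>%VS -> s2 \in <<1; r>>%VS ->
  s1 ^+ 2 = s0 ^+ 2 + m%:~R -> s2 ^+ 2 = s0 ^+ 2 + n%:~R ->
  s0 ^+ 2 \in (1%AS : {subfield K}) /\ s0 * s1 * s2 \in (1%AS : {subfield K}).
Proof.
move=> hd hr NT k0 k1 k2 h1 h2; have sr := sqrt_disc hd hr; have [r2 _] := sr.
have [s0' c0] := @conj_exists K 1%AS r s0 r2 k0.
have [s1' c1] := @conj_exists K 1%AS r s1 r2 k1.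
have [s2' c2] := @conj_exists K 1%AS r s2 r2 k2.
by apply: (addition_twist sr _ _ (no_twist_alg hr NT) c0 c1 c2 h1 h2); mem.
Qed.

(** The four goals come in the order -1, 3, 2, -2; for each field the caller then picks an integer
    that is not a square there. *)
Ltac nonsquares hd := move: hd; rewrite !inE => /or4P[] /eqP->.

Lemma only_zero14_disc (K : fieldExtType rat) (d : int) (r s0 s1 s2 : K) :
  d \in discriminants -> r ^+ 2 = d%:~R ->
  s0 \in <<1; r>>%VS -> s1 \in <<1; r>>%VS -> s2 \in <<1; r>>%VS ->
  s1 ^+ 2 = s0 ^+ 2 + 1 -> s2 ^+ 2 = s0 ^+ 2 + 4 -> s0 = 0.
Proof.
move=> hd hr k0 k1 k2 h1 h2.
have nsq := int_sqr_in_disc_field hd hr.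
have [w v] := rational_sum_and_product hd hr (no_twist14 hd) k0 k1 k2 h1 h2.
have v2 : (s0 * s1 * s2) ^+ 2 = s0 ^+ 2 * (s0 ^+ 2 + 1) * (s0 ^+ 2 + 4).
  by rewrite -h1 -h2; ring.
have [v0|v0] := eqVneq (s0 * s1 * s2) 0; last first.
  have [| | x [y [z [[xQ yQ zQ] [hy hz e]]]]] := doubling _ _ w v v0 v2; try mem.
  (* The double has abscissa 0, so [w^2 = 4]. Now [w = 2] needs square roots of 2 and 3, and
     [w = -2] needs those of -2 and 2; no field on the list contains both. *)
  rewrite (only_zero14_alg xQ yQ zQ hy hz) mulr0 in e.
  have /sqr_eqP[e2|e2] : (s0 ^+ 2) ^+ 2 = 2 ^+ 2 by apply/eqP; rewrite -subr_eq0; apply/eqP; rewrite e; ring.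
    have [z1 z2] : s0 ^+ 2 = 2%:~R /\ s1 ^+ 2 = 3%:~R by rewrite h1 e2; split=> //; ring.
    exfalso; have := nsq _ _ k0 z1; have := nsq _ _ k1 z2.
    by nonsquares hd => A B; [apply: A | apply: B | apply: A | apply: A].
  have [z1 z2] : s0 ^+ 2 = (-2)%:~R /\ s2 ^+ 2 = 2%:~R by rewrite h2 e2; split; ring.
  exfalso; have := nsq _ _ k0 z1; have := nsq _ _ k2 z2.
  by nonsquares hd => A B; [apply: A | apply: A | apply: B | apply: A].
move/eqP: v0; rewrite !mulf_eq0 => /orP[/orP[/eqP//|]|] /eqP e.
  have e0 : s0 ^+ 2 = (-1)%:~R by apply/eqP; rewrite rmorphN rmorph1 -addr_eq0 -h1 e expr0n.
  have e2 : s2 ^+ 2 = 3%:~R by rewrite h2 e0; ring.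
  exfalso; have := nsq _ _ k0 e0; have := nsq _ _ k2 e2.
  by nonsquares hd => A B; [apply: A | apply: B | apply: B | apply: B].
have e0 : s0 ^+ 2 = - 4 by apply/eqP; rewrite -addr_eq0 -h2 e expr0n.
have e1 : s1 ^+ 2 = (-3)%:~R by rewrite h1 e0; ring.
by exfalso; have := nsq _ _ k1 e1; nonsquares hd; apply.
Qed.

(** The exception is a genuine point over Q(sqrt 3), with squares 3, 4, 12; it solves [w^2 = 9],
    that is, its double has abscissa 0. *)
Lemma zero_or_three19_disc (K : fieldExtType rat) (d : int) (r s0 s1 s2 : K) :
  d \in discriminants -> r ^+ 2 = d%:~R ->
  s0 \in <<1; r>>%VS -> s1 \in <<1; r>>%VS -> s2 \in <<1; r>>%VS ->
  s1 ^+ 2 = s0 ^+ 2 + 1 -> s2 ^+ 2 = s0 ^+ 2 + 9 -> s0 = 0 \/ s0 ^+ 2 = 3 /\ d = 3.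
Proof.
move=> hd hr k0 k1 k2 h1 h2.
have nsq := int_sqr_in_disc_field hd hr.
have [w v] := rational_sum_and_product hd hr (no_twist19 hd) k0 k1 k2 h1 h2.
have v2 : (s0 * s1 * s2) ^+ 2 = s0 ^+ 2 * (s0 ^+ 2 + 1) * (s0 ^+ 2 + 9).
  by rewrite -h1 -h2; ring.
have [v0|v0] := eqVneq (s0 * s1 * s2) 0; last first.
  have [| | x [y [z [[xQ yQ zQ] [hy hz e]]]]] := doubling _ _ w v v0 v2; try mem.
  rewrite (only_zero19_alg xQ yQ zQ hy hz) mulr0 in e.
  have /sqr_eqP[e2|e2] : (s0 ^+ 2) ^+ 2 = 3 ^+ 2 by apply/eqP; rewrite -subr_eq0; apply/eqP; rewrite e; ring.
    have z1 : s0 ^+ 2 = 3%:~R by [].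
    have := nsq _ _ k0 z1.
    by nonsquares hd => A; [case: A | right | case: A | case: A].
  have [z1 z2] : s0 ^+ 2 = (-3)%:~R /\ s2 ^+ 2 = 6%:~R by rewrite h2 e2; split; ring.
  by exfalso; have := nsq _ _ k2 z2; nonsquares hd; apply.
move/eqP: v0; rewrite !mulf_eq0 => /orP[/orP[/eqP|]|] => [|/eqP e|/eqP e]; first by left.
  have e0 : s0 ^+ 2 = (-1)%:~R by apply/eqP; rewrite rmorphN rmorph1 -addr_eq0 -h1 e expr0n.
  have e2 : s2 ^+ 2 = 8%:~R by rewrite h2 e0; ring.
  exfalso; have := nsq _ _ k0 e0; have := nsq _ _ k2 e2.
  by nonsquares hd => A B; [apply: A | apply: B | apply: B | apply: B].
have e0 : s0 ^+ 2 = (-9)%:~R by apply/eqP; rewrite rmorphN rmorph_nat -addr_eq0 -h2 e expr0n.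
have e1 : s1 ^+ 2 = (-8)%:~R by rewrite h1 e0; ring.
exfalso; have := nsq _ _ k0 e0; have := nsq _ _ k1 e1.
by nonsquares hd => A B; [apply: A | apply: B | apply: B | apply: B].
Qed.

Lemma of_ratE (K : fieldExtType rat) :
  ({morph of_rat K : x y / x + y} * {morph of_rat K : x y / x * y})
  * (forall n, {morph of_rat K : x / x ^+ n}) * (forall n, of_rat K n%:R = n%:R)
  * (forall z, of_rat K z%:~R = z%:~R) * (of_rat K 1 = 1).
Proof.
split; last exact: rmorph1; split; last exact: rmorph_int; split; last exact: rmorph_nat.
by split; [split; [exact: rmorphD | exact: rmorphM] | exact: rmorphXn].
Qed.

Lemma no_rational_pair (i j l i' j' l' : int) :
  (forall N, (exists A B C : int, i * A ^+ 2 + j * B ^+ 2 = l * N ^+ 2 /\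
    i' * A ^+ 2 + j' * C ^+ 2 = l' * N ^+ 2) -> N = 0) ->
  forall x y z : rat, i%:~R * x ^+ 2 + j%:~R * y ^+ 2 = l%:~R ->
    i'%:~R * x ^+ 2 + j'%:~R * z ^+ 2 = l'%:~R -> False.
Proof.
move=> H x y z; have [A [B [C [N [N0 -> -> ->]]]]] := rat_common_denominator x y z.
have n0 : N%:~R != 0 :> rat by rewrite intr_eq0.
have clear (a b c X Y : int) :
    a%:~R * (X%:~R / N%:~R) ^+ 2 + b%:~R * (Y%:~R / N%:~R) ^+ 2 = c%:~R :> rat ->
    a * X ^+ 2 + b * Y ^+ 2 = c * N ^+ 2.
  move=> e; apply: (@intr_inj rat); rewrite [LHS]rmorphD !rmorphM /= -e.
  by field.
move=> /clear h1 /clear h2; case/eqP: N0; apply: H.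
by exists A, B, C.
Qed.

(** For [d = 3], two of [s0], [s1], [s2] might be rational multiples of sqrt 3. The three systems
    are those for the pairs [(s0, s1)], [(s0, s2)], [(s1, s2)]; all fail by descent at 3. *)
Lemma mixed_signs3 :
  [/\ forall N, (exists A B C : int, (-3) * A ^+ 2 + 3 * B ^+ 2 = 2 * N ^+ 2 /\
        (-3) * A ^+ 2 + 1 * C ^+ 2 = 6 * N ^+ 2) -> N = 0,
      forall N, (exists A B C : int, (-3) * A ^+ 2 + 1 * B ^+ 2 = 2 * N ^+ 2 /\
        (-3) * A ^+ 2 + 3 * C ^+ 2 = 6 * N ^+ 2) -> N = 0
    & forall N, (exists A B C : int, (-1) * A ^+ 2 + 3 * B ^+ 2 = 2 * N ^+ 2 /\
        (-1) * A ^+ 2 + 3 * C ^+ 2 = 6 * N ^+ 2) -> N = 0].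
Proof.
split; apply: descent3 => N [A [B [C [e1 e2]]]].
- have [|N' eN] := @sqr_dvd3 N (A ^+ 2 - B ^+ 2 + N ^+ 2); first lra.
  have [|C' eC] := @sqr_dvd3 C (A ^+ 2 + 2 * N ^+ 2); first lra.
  rewrite eN eC in e1 e2.
  have [|A' eA] := @sqr_dvd3 A (C' ^+ 2 - 6 * N' ^+ 2); first lra.
  rewrite eA in e1 e2.
  have [|B' eB] := @sqr_dvd3 B (3 * A' ^+ 2 + 2 * N' ^+ 2); first lra.
  by exists N' => //; exists A', B', C'; rewrite eB in e1; split; lra.
- have [|[B' eB] [N' eN]] := @sum_sqr_dvd3 B N (A ^+ 2 + N ^+ 2); first lra.
  rewrite eN eB in e1 e2.
  have [|A' eA] := @sqr_dvd3 A (B' ^+ 2 - 2 * N' ^+ 2); first lra.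
  rewrite eA in e1 e2.
  have [|C' eC] := @sqr_dvd3 C (3 * A' ^+ 2 + 6 * N' ^+ 2); first lra.
  by exists N' => //; exists A', B', C'; rewrite eC in e2; split; lra.
have [|A' eA] := @sqr_dvd3 A (C ^+ 2 - 2 * N ^+ 2); first lra.
rewrite eA in e1 e2.
have [|N' eN] := @sqr_dvd3 N (N ^+ 2 - B ^+ 2 + 3 * A' ^+ 2); first lra.
rewrite eN in e1 e2.
have [|B' eB] := @sqr_dvd3 B (A' ^+ 2 + 2 * N' ^+ 2); first lra.
have [|C' eC] := @sqr_dvd3 C (A' ^+ 2 + 6 * N' ^+ 2); first lra.
by exists N' => //; exists A', B', C'; rewrite eB eC in e1 e2; split; lra.
Qed.

(** For [d = -1] with [s0] and [s1] multiples of i. One equation suffices; it is repeated to fit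
    [no_rational_pair]. *)
Lemma mixed_signs1 (N : int) : (exists A B C : int, 1 * A ^+ 2 + 1 * B ^+ 2 = 6 * N ^+ 2 /\
  1 * A ^+ 2 + 1 * C ^+ 2 = 6 * N ^+ 2) -> N = 0.
Proof. by case=> A [B [C [e _]]]; apply: sum_sqr_eq6; exists A, B; rewrite !mul1r in e. Qed.

Lemma sqrt_rational (K : fieldExtType rat) (d : int) (r s : K) :
  d \in discriminants -> r ^+ 2 = d%:~R -> s \in <<1; r>>%VS ->
  s ^+ 2 \in (1%AS : {subfield K}) ->
  (exists q, s = of_rat K q) \/ (exists q, s = of_rat K q * r).
Proof.
move=> hd hr sk sQ; have sr := sqrt_disc hd hr; have [r2 _] := sr.
have [s' cs] := @conj_exists K 1%AS r s r2 sk.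
case: (conj_sqr sr cs sQ) => e; rewrite e in cs.
  by left; apply: mem_ratP (conj_fixed cs).
by right; have [b /mem_ratP[q ->]] := conj_anti cs; exists q.
Qed.

Lemma of_rat_mem (K : fieldExtType rat) q : of_rat K q \in (1%AS : {subfield K}).
Proof. by apply/vlineP; exists q. Qed.

Lemma rational_points26 (K : fieldExtType rat) (d : int) (r s0 s1 s2 : K) :
  d = -1 \/ d = 3 -> r ^+ 2 = d%:~R ->
  s0 \in <<1; r>>%VS -> s1 \in <<1; r>>%VS -> s2 \in <<1; r>>%VS ->
  s1 ^+ 2 = s0 ^+ 2 + 2 -> s2 ^+ 2 = s0 ^+ 2 + 6 ->
  [/\ s0 \in (1%AS : {subfield K}), s1 \in (1%AS : {subfield K}),
      s2 \in (1%AS : {subfield K}) & s0 * s1 * s2 != 0].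
Proof.
move=> hd13 hr k0 k1 k2 h1 h2.
have hd : d \in discriminants by case: hd13 => ->.
have [r2 rQ] := sqrt_disc hd hr.
have nsq := int_sqr_in_disc_field hd hr.
have [w v] := rational_sum_and_product hd hr (no_twist26 hd13) k0 k1 k2 h1 h2.
have v0 : s0 * s1 * s2 != 0.
  apply/negP; rewrite !mulf_eq0 => /orP[/orP[]|] /eqP e.
  - have e1 : s1 ^+ 2 = 2%:~R by rewrite h1 e; ring.
    by have := nsq _ _ k1 e1; case: hd13 => ->; apply.
  - have e0 : s0 ^+ 2 = (-2)%:~R by apply/eqP; rewrite rmorphN -addr_eq0 -h1 e expr0n.
    by have := nsq _ _ k0 e0; case: hd13 => ->; apply.
  have e0 : s0 ^+ 2 = (-6)%:~R by apply/eqP; rewrite rmorphN -addr_eq0 -h2 e expr0n.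
  by have := nsq _ _ k0 e0; case: hd13 => ->; apply.
(* The product [s0 s1 s2] is rational and nonzero, so the number of factors that are multiples of
   [r] is even. *)
have oddr q : q * r = s0 * s1 * s2 -> q \in (1%AS : {subfield K}) -> False.
  move=> e qQ; case/negP: rQ; have q0 : q != 0 by apply: contraNneq v0 => q0; rewrite -e q0 mul0r.
  by have -> : r = (s0 * s1 * s2) / q; [rewrite -e mulrC mulKf | mem].
have r0 : r != 0 by apply: contraNneq rQ => ->; mem.
have toQ (x y : rat) (n : nat) (a b : bool) :
    (of_rat K y * (if b then r else 1)) ^+ 2 = (of_rat K x * (if a then r else 1)) ^+ 2 + n%:R ->
    (if b then d%:~R else 1) * y ^+ 2 = (if a then d%:~R else 1) * x ^+ 2 + n%:R.
  have sq (c : bool) : of_rat K (if c then d%:~R else 1) = (if c then r else 1) ^+ 2.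
    by case: c; rewrite ?hr ?of_ratE ?expr1n.
  by move=> e; apply: (@of_rat_inj K); rewrite !of_ratE !sq mulrC -exprMn e; ring.
have w1 : s1 ^+ 2 \in (1%AS : {subfield K}) by rewrite h1; mem.
have w2 : s2 ^+ 2 \in (1%AS : {subfield K}) by rewrite h2; mem.
have [[x ex]|[x ex]] := sqrt_rational hd hr k0 w;
  have [[y ey]|[y ey]] := sqrt_rational hd hr k1 w1;
  have [[z ez]|[z ez]] := sqrt_rational hd hr k2 w2.
- by split; rewrite ?ex ?ey ?ez; try exact: of_rat_mem; rewrite -ex -ey -ez.
- by case: (oddr (of_rat K (x * y * z))); [rewrite !of_ratE ex ey ez; ring | apply: of_rat_mem].
- by case: (oddr (of_rat K (x * y * z))); [rewrite !of_ratE ex ey ez; ring | apply: of_rat_mem].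
- have [] := And3 (toQ x y 2 false true) (toQ x z 6 false true) isT.
  rewrite !mulr1 -ex -ey -ez !mul1r => /(_ h1) g1 /(_ h2) g2 _; exfalso.
  case: hd13 g1 g2 => -> g1 g2; first by have := sqr_ge0 x; have := sqr_ge0 y; nra.
  case: mixed_signs3 => _ _ H; by apply: (no_rational_pair H (x := x) (y := y) (z := z)); clear -g1 g2; lra.
- by case: (oddr (of_rat K (x * y * z))); [rewrite !of_ratE ex ey ez; ring | apply: of_rat_mem].
- have [] := And3 (toQ x y 2 true false) (toQ x z 6 true true) isT.
  rewrite !mulr1 -ex -ey -ez !mul1r => /(_ h1) g1 /(_ h2) g2 _; exfalso.
  case: hd13 g1 g2 => -> g1 g2.
    by have := sqr_ge0 x; have := sqr_ge0 y; have := sqr_ge0 z; nra.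
  case: mixed_signs3 => _ H _; by apply: (no_rational_pair H (x := x) (y := y) (z := z)); clear -g1 g2; lra.
- have [] := And3 (toQ x y 2 true true) (toQ x z 6 true false) isT.
  rewrite !mulr1 -ex -ey -ez !mul1r => /(_ h1) g1 /(_ h2) g2 _; exfalso.
  case: hd13 g1 g2 => -> g1 g2.
    have e : 1%:~R * x ^+ 2 + 1%:~R * z ^+ 2 = 6%:~R :> rat by clear -g2; lra.
    exact: (no_rational_pair mixed_signs1 e e).
  by case: mixed_signs3 => H _ _; apply: (no_rational_pair H (x := x) (y := y) (z := z)); clear -g1 g2; lra.
case: (oddr (of_rat K (x * y * z * d%:~R))); last exact: of_rat_mem.
by rewrite !of_ratE ex ey ez -hr; ring.
Qed.

(** * Five squares over a quadratic extension of Q(sqrt d) *)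

Definition quadratic_tower (K : fieldExtType rat) (d : int) (r t : K) : Prop :=
  [/\ d \in discriminants, r ^+ 2 = d%:~R, sqrt_over <<1; r>>%AS t
    & <<<<1; r>>; t>>%VS = fullv].

Lemma tower_conj (K : fieldExtType rat) d (r t x : K) :
  quadratic_tower d r t -> exists y, conjugate <<1; r>>%AS t x y.
Proof.
by move=> [_ _ [tk _] full]; apply: conj_exists => //; have := memvf x; rewrite -full.
Qed.

Lemma conj_unchanged (K : fieldExtType rat) (F : {subfield K}) t x y :
  conjugate F t x y -> y = x -> x \in F.
Proof. by move=> c e; rewrite e in c; apply: conj_fixed c. Qed.

Lemma conj_neq0 (K : fieldExtType rat) (F : {subfield K}) t x y : t \notin F ->
  conjugate F t x y -> x != 0 -> y != 0.
Proof.
move=> tF c; apply: contraNneq => y0; rewrite y0 in c.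
by apply/eqP; symmetry; apply: (conj_uniq tF (conj_mem t (rpred0 _)) (conjC c)).
Qed.

Lemma conj_uniqM (K : fieldExtType rat) (F : {subfield K}) t x x' y y' z z' :
  sqrt_over F t -> conjugate F t x x' -> conjugate F t y y' -> conjugate F t z z' ->
  z = x * y -> z' = x' * y'.
Proof.
move=> [t2 tF] cx cy cz e; rewrite e in cz; exact: (conj_uniq tF cz (conjM t2 cx cy)).
Qed.

(* [xi] is twice the centre of the progression in units of [D].  The triple [s0, s1, s2]
   below is a point of the curve of [w, w + 1, w + 4] with [s1 s2 = xi s0]; conjugation
   either fixes [xi] and exchanges [w] with [4 / w], or reflects the progression. *)
Lemma four_squares (K : fieldExtType rat) d (r t x0 x1 x2 x3 D xi y xi' y' : K) :
  quadratic_tower d r t -> D != 0 ->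
  x1 ^+ 2 = x0 ^+ 2 + D -> x2 ^+ 2 = x0 ^+ 2 + 2 * D -> x3 ^+ 2 = x0 ^+ 2 + 3 * D ->
  xi * D = x0 ^+ 2 + x3 ^+ 2 -> y * D ^+ 2 = x0 * x1 * x2 * x3 ->
  conjugate <<1; r>>%AS t xi xi' -> conjugate <<1; r>>%AS t y y' ->
  xi' = - xi \/ xi \in <<1; r>>%AS /\ [\/ y = 0, xi = 0 | y' = - y].
Proof.
move=> tw D0 h1 h2 h3 hxi hy cxi cy.
have [hd hr st full] := tw; have [t2 tk] := st.
have n2 := natK_neq0 K 1.
(* The three ways to pair the four roots. The squares share the cross term [2 y], so they differ by
   [(x1^2 - x0^2) (x3^2 - x2^2) / D^2 = 1] and [(x2^2 - x0^2) (x3^2 - x1^2) / D^2 = 4]. *)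
pose s0 := (x0 * x3 + x1 * x2) / D; pose s1 := (x0 * x2 + x1 * x3) / D.
pose s2 := (x0 * x1 + x2 * x3) / D.
have xiE : xi = (2 * x0 ^+ 2 + 3 * D) / D by apply: (mulIf D0); rewrite hxi divfK // h3; ring.
have x0E : x0 ^+ 2 = (xi - 3) / 2 * D by rewrite xiE; field; rewrite n2 D0.
have yE : y = x0 * x1 * x2 * x3 / D ^+ 2 by rewrite -hy mulfK // expf_neq0.
(* [T] and [T + 2] are [x0^2 x3^2 / D^2] and [x1^2 x2^2 / D^2]. *)
pose T := (xi ^+ 2 - 9) / 4.
have wE : s0 ^+ 2 = 2 * T + 2 + 2 * y.
  transitivity ((x0 ^+ 2 * x3 ^+ 2 + x1 ^+ 2 * x2 ^+ 2 + 2 * (x0 * x1 * x2 * x3)) / D ^+ 2).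
    by rewrite /s0; field.
  by rewrite h1 h2 h3 -hy x0E /T; field; rewrite D0 n2 (natK_neq0 K 3).
have w1 : s1 ^+ 2 = s0 ^+ 2 + 1.
  apply/eqP; rewrite -subr_eq0; apply/eqP.
  transitivity ((x0 ^+ 2 * x2 ^+ 2 + x1 ^+ 2 * x3 ^+ 2 - x0 ^+ 2 * x3 ^+ 2 - x1 ^+ 2 * x2 ^+ 2
    - D ^+ 2) / D ^+ 2); first by rewrite /s0 /s1; field.
  by rewrite h1 h2 h3 -[RHS](mul0r (D ^- 2)); congr (_ / _); ring.
have w2 : s2 ^+ 2 = s0 ^+ 2 + 4.
  apply/eqP; rewrite -subr_eq0; apply/eqP.
  transitivity ((x0 ^+ 2 * x1 ^+ 2 + x2 ^+ 2 * x3 ^+ 2 - x0 ^+ 2 * x3 ^+ 2 - x1 ^+ 2 * x2 ^+ 2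
    - 4 * D ^+ 2) / D ^+ 2); first by rewrite /s0 /s2; field.
  by rewrite h1 h2 h3 -[RHS](mul0r (D ^- 2)); congr (_ / _); ring.
have s12 : s1 * s2 = xi * s0.
  transitivity ((x1 * x2 * (x0 ^+ 2 + x3 ^+ 2) + x0 * x3 * (x1 ^+ 2 + x2 ^+ 2)) / D ^+ 2).
    by rewrite /s1 /s2; field.
  by rewrite h1 h2 h3 /s0 xiE; field.
have y2 : y ^+ 2 = T * (T + 2).
  transitivity (x0 ^+ 2 * x1 ^+ 2 * x2 ^+ 2 * x3 ^+ 2 / D ^+ 4); first by rewrite yE; field.
  by rewrite h1 h2 h3 x0E /T; field; rewrite D0 n2 (natK_neq0 K 3).
have s00 : s0 != 0.
  apply/negP => /eqP s0z; have : s1 ^+ 2 * s2 ^+ 2 = (4 : K).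
    by rewrite w1 w2 s0z; ring.
  by rewrite -exprMn s12 s0z mulr0 expr0n /= => /esym/eqP; rewrite (negPf (natK_neq0 K 3)).
clearbody s0 s1 s2.
have [s0' c0] := tower_conj s0 tw; have [s1' c1] := tower_conj s1 tw.
have [s2' c2] := tower_conj s2 tw.
have s12' : s1' * s2' = xi' * s0'.
  symmetry; apply: (conj_uniqM st c1 c2 (z := xi * s0)); last by rewrite s12.
  exact: conjM.
have [m1 m4] : (1 : K) \in <<1; r>>%AS /\ (4 : K) \in <<1; r>>%AS by split; mem.
have [ww|ww] := eqVneq (s0 ^+ 2) (s0' ^+ 2); last first.
  (* The sum with the conjugate has abscissa 0, so [s0 s1' s2' = s0' s1 s2], and [s1 s2 = xi s0]
     turns this into [xi' = xi]. Then [y] must change sign, since otherwise [s0^2] would lie in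
     [k]. *)
  right; have [p [q [e [[pk qk ek] [hq he hp]]]]] :=
    addition_trace st m1 m4 c0 c1 c2 w1 w2 ww.
  have xixi : xi' = xi.
    rewrite (only_zero14_disc hd hr pk qk ek hq he) mul0r in hp.
    have e0 : (xi' - xi) * (s0 * s0') = 0.
      transitivity (s0 * (s1' * s2') - s0' * (s1 * s2)); first by rewrite s12 s12'; ring.
      by rewrite !mulrA -hp.
    move/eqP: e0; rewrite !mulf_eq0 (negPf s00) (negPf (conj_neq0 tk c0 s00)) !orbF.
    by rewrite subr_eq0 => /eqP.
  have xk := conj_unchanged cxi xixi; split=> //; constructor 3.
  have Tk : T \in <<1; r>>%AS by rewrite /T; mem.
  have [|e'|//] := conj_sqr st cy; first by rewrite y2; mem.
  have yk := conj_unchanged cy e'.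
  by case/eqP: ww; symmetry; apply: (conj_uniqF tk (conjX 2 t2 c0)); rewrite wE; mem.
have wk : s0 ^+ 2 \in <<1; r>>%AS by apply: (conj_unchanged (conjX 2 t2 c0)).
pose v := s0 * s1 * s2; have vE : v = xi * s0 ^+ 2 by rewrite /v -mulrA s12; ring.
have v2 : v ^+ 2 = s0 ^+ 2 * (s0 ^+ 2 + 1) * (s0 ^+ 2 + 4) by rewrite -w1 -w2 /v; ring.
have xi2 : xi ^+ 2 = (s0 ^+ 2 + 1) * (s0 ^+ 2 + 4) / s0 ^+ 2.
  by apply: (mulIf (expf_neq0 2 (expf_neq0 2 s00))); rewrite -exprMn -vE v2; field.
have [|xx|] := conj_sqr st cxi; [by rewrite xi2; mem | right | by left].
have xk := conj_unchanged cxi xx; split=> //.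
have vk : v \in <<1; r>>%AS by rewrite vE; mem.
have [v0|v0] := eqVneq v 0.
  constructor 2; apply/eqP; move/eqP: v0.
  by rewrite vE mulf_eq0 (negPf (expf_neq0 2 s00)) orbF.
constructor 1.
(* The double has abscissa 0, hence [w^2 = 4] for [w = s0^2]; and [4 y w = w^2 - 4] by the formulas
   for [w] and [y^2]. *)
have [p [q [e [[pk qk ek] [hq he hp]]]]] := doubling m1 m4 wk vk v0 v2.
rewrite (only_zero14_disc hd hr pk qk ek hq he) mulr0 in hp.
have : 4 * y * s0 ^+ 2 = 0.
  transitivity ((s0 ^+ 2) ^+ 2 - 1 * 4 + 4 * (y ^+ 2 - T * (T + 2))); first by rewrite wE; ring.
  by rewrite -hp y2; ring.
by move/eqP; rewrite !mulf_eq0 (negPf (natK_neq0 K 3)) (negPf s00) /= !orbF => /eqP.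
Qed.

(* If [a] and [b] are squares in a quadratic extension of [Q(sqrt d)], then one of
   [a], [b], [a b] is a square in [Q(sqrt d)]. *)
Definition not_both_squares (d a b : int) :=
  all small_nonsquare [:: a; a * d; b; b * d; a * b; a * b * d].

Lemma not_both_squaresP (K : fieldExtType rat) (d a b : int) (r t x y : K) :
  quadratic_tower d r t -> not_both_squares d a b ->
  x ^+ 2 = a%:~R -> y ^+ 2 = b%:~R -> False.
Proof.
move=> tw /and5P[na nad nb nbd /and3P[nab nabd _]] xa yb.
have [hd hr st _] := tw; have [x' cx] := tower_conj x tw; have [y' cy] := tower_conj y tw.
have nsq := int_sqr_in_disc_field hd hr.
case: (conj_sqr st cx) => [|ex|ex]; first by rewrite xa; mem.
  exact: (nsq _ _ (conj_unchanged cx ex) xa).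
case: (conj_sqr st cy) => [|ey|ey]; first by rewrite yb; mem.
  exact: (nsq _ _ (conj_unchanged cy ey) yb).
have xyk : x * y \in <<1; r>>%AS.
  by apply: (conj_unchanged (conjM (proj1 st) cx cy)); rewrite ex ey mulrNN.
by apply: (nsq _ (a * b) xyk); rewrite // exprMn xa yb -rmorphM.
Qed.

Lemma sqr_ratio (K : fieldExtType rat) (x y : K) (z : int) :
  y != 0 -> x ^+ 2 = z%:~R * y ^+ 2 -> (x / y) ^+ 2 = z%:~R.
Proof. by move=> y0 e; rewrite exprMn e exprVn mulfK // expf_neq0. Qed.

(** The norm of [3 + 2 sqrt 3] is -3, which is not a rational square. This removes the exceptional
    value [s0^2 = 3] over Q(sqrt 3). *)
Lemma no_halving_of_three (K : fieldExtType rat) (d : int) (r rho x : K) :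
  d \in discriminants -> r ^+ 2 = d%:~R -> rho \in <<1; r>>%VS -> x \in <<1; r>>%VS ->
  rho ^+ 2 = 3 -> x ^+ 2 = 3 + 2 * rho -> False.
Proof.
move=> hd hr rk xk r3 x2; have sr := sqrt_disc hd hr; have [r2 rQ] := sr.
have nsq := int_sqr_in_disc_field hd hr.
have [rho' cr] := @conj_exists K 1%AS r rho r2 rk.
have [x' cx] := @conj_exists K 1%AS r x r2 xk.
have x2' : x' ^+ 2 = 3 + 2 * rho'.
  apply: (conj_uniq rQ (conjX 2 r2 cx)); rewrite x2.
  by apply: conjD; [|apply: conjM => //]; try apply: conj_mem; mem.
case: (conj_sqr sr cr) => [|e|e]; first by rewrite r3; mem.
  have := conj_unchanged cr e; case/mem_ratP=> q qr.
  suff : q ^+ 2 = 3%:~R by case/rat_sqr_int=> b /small_nonsquareP; apply.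
  by apply: (@of_rat_inj K); rewrite !of_ratE -qr r3.
have nQ : x * x' \in (1%AS : {subfield K}).
  by apply: (conj_fixed (t := r)); rewrite {2}mulrC; apply: conjM => //; apply: conjC.
case/mem_ratP: nQ => q qr.
suff : q ^+ 2 = (-3)%:~R by case/rat_sqr_int=> b /small_nonsquareP; apply.
apply: (@of_rat_inj K); rewrite !of_ratE -qr exprMn x2 x2' e.
transitivity (9 - 4 * rho ^+ 2); first by ring.
by rewrite r3; ring.
Qed.

Lemma five_squares_centre (K : fieldExtType rat) d (r t x0 x1 x2 x3 x4 D u : K) :
  quadratic_tower d r t -> D != 0 ->
  x0 ^+ 2 = x2 ^+ 2 - 2 * D -> x1 ^+ 2 = x2 ^+ 2 - D ->
  x3 ^+ 2 = x2 ^+ 2 + D -> x4 ^+ 2 = x2 ^+ 2 + 2 * D -> u * D = x2 ^+ 2 ->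
  u \in <<1; r>>%AS /\
  [\/ x0 * x1 * x2 * x3 * x4 = 0, 2 * u = 1 \/ 2 * u = - 1
    | conjugate <<1; r>>%AS t (x0 * x1 * x2 * x3 / D ^+ 2) (- (x0 * x1 * x2 * x3 / D ^+ 2)) /\
      conjugate <<1; r>>%AS t (x1 * x2 * x3 * x4 / D ^+ 2) (- (x1 * x2 * x3 * x4 / D ^+ 2))].
Proof.
move=> tw D0 h0 h1 h3 h4 hu; have [hd hr st _] := tw; have [t2 tk] := st.
have D2 : D ^+ 2 != 0 by rewrite expf_neq0.
have n2 := natK_neq0 K 1.
set y1 := x0 * x1 * x2 * x3 / D ^+ 2; set y2 := x1 * x2 * x3 * x4 / D ^+ 2.
have [u' cu] := tower_conj u tw.
have [y1' cy1] := tower_conj y1 tw; have [y2' cy2] := tower_conj y2 tw.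
have c1 : conjugate <<1; r>>%AS t (2 * u - 1) (2 * u' - 1).
  by apply: conjD; [apply: conjM => //|]; apply: conj_mem; mem.
have c2 : conjugate <<1; r>>%AS t (2 * u + 1) (2 * u' + 1).
  by apply: conjD; [apply: conjM => //|]; apply: conj_mem; mem.
have := @four_squares K d r t x0 x1 x2 x3 D _ y1 _ y1' tw D0 _ _ _ _ _ c1 cy1.
case; [by rewrite h1 h0; ring | by rewrite h0; ring | by rewrite h3 h0; ring
  | by rewrite h3 h0 -hu; ring | by rewrite /y1 divfK | |].
all: have := @four_squares K d r t x1 x2 x3 x4 D _ y2 _ y2' tw D0 _ _ _ _ _ c2 cy2.
all: case; [by rewrite h1; ring | by rewrite h3 h1; ring | by rewrite h4 h1; ring
  | by rewrite h4 h1 -hu; ring | by rewrite /y2 divfK | |].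
(* Reflecting both would mean [2 u' - 1 = 1 - 2 u] and [2 u' + 1 = - 1 - 2 u], whence 4 = 0. *)
- move=> e2 e1; case/eqP: (natK_neq0 K 3).
  transitivity (2 * u' + 1 + (2 * u + 1) - (2 * u' - 1 + (2 * u - 1))); first by ring.
  by rewrite e1 e2; ring.
(* One subprogression is fixed, so [u] lies in [k]; the other is reflected, so its centre is 0. *)
- move=> [uk _] e1; have uk' : u \in <<1; r>>%AS.
    by have -> : u = (2 * u + 1 - 1) / 2; [field | mem].
  split=> //; constructor 2; left; move: e1; rewrite (conj_uniqF tk cu uk') => e1.
  apply/eqP; rewrite -subr_eq0; apply/eqP; apply: (mulfI n2); rewrite mulr0.
  by rewrite -(subrr (2 * u - 1)) {3}e1; ring.
- move=> e2 [uk _]; have uk' : u \in <<1; r>>%AS.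
    by have -> : u = (2 * u - 1 + 1) / 2; [field | mem].
  split=> //; constructor 2; right; move: e2; rewrite (conj_uniqF tk cu uk') => e1.
  apply/eqP; rewrite -subr_eq0; apply/eqP; apply: (mulfI n2); rewrite mulr0.
  by rewrite -(subrr (2 * u + 1)) {2}e1; ring.
move=> [_ H2] [uk H1]; have uk' : u \in <<1; r>>%AS.
  by have -> : u = (2 * u - 1 + 1) / 2; [field | mem].
split=> //.
case: H1 => [e1|e1|e1].
- constructor 1; have -> : x0 * x1 * x2 * x3 = y1 * D ^+ 2 by rewrite /y1 divfK.
  by rewrite e1 !mul0r.
- by constructor 2; left; apply/eqP; rewrite -subr_eq0 e1.
case: H2 => [e2|e2|e2].
- constructor 1; have -> : x0 * x1 * x2 * x3 * x4 = x0 * (y2 * D ^+ 2).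
    by rewrite /y2 divfK //; ring.
  by rewrite e2 mul0r mulr0.
- by constructor 2; right; apply/eqP; rewrite -addr_eq0 e2.
by constructor 3; rewrite e1 in cy1; rewrite e2 in cy2.
Qed.

Definition five_ap (K : fieldExtType rat) (D x0 x1 x2 x3 x4 : K) : Prop :=
  [/\ x0 ^+ 2 = x2 ^+ 2 - 2 * D, x1 ^+ 2 = x2 ^+ 2 - D,
      x3 ^+ 2 = x2 ^+ 2 + D & x4 ^+ 2 = x2 ^+ 2 + 2 * D].

Lemma five_ap_rev (K : fieldExtType rat) (D x0 x1 x2 x3 x4 : K) :
  five_ap D x0 x1 x2 x3 x4 -> five_ap (- D) x4 x3 x2 x1 x0.
Proof. by move=> [h0 h1 h3 h4]; split; rewrite ?h0 ?h1 ?h3 ?h4; ring. Qed.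

(** Up to scaling the squares would be -1, 0, 1, 2, 3, and square roots of -1, 2 and 3 are too many
    for a field of degree 4. *)
Lemma no_five_ap_second_zero (K : fieldExtType rat) d (r t x0 x1 x2 x3 x4 D : K) :
  quadratic_tower d r t -> D != 0 -> five_ap D x0 x1 x2 x3 x4 -> x1 != 0.
Proof.
move=> tw D0 [h0 h1 h3 h4]; apply/eqP => x10.
have DE : D = x2 ^+ 2 by apply/eqP; rewrite eq_sym -subr_eq0 -h1 x10 expr0n.
have x20 : x2 != 0 by apply: contraNneq D0 => e; rewrite DE e expr0n.
rewrite DE in h0 h3 h4.
have q0 : (x0 / x2) ^+ 2 = (-1)%:~R by apply: sqr_ratio => //; rewrite h0; ring.
have q3 : (x3 / x2) ^+ 2 = 2%:~R by apply: sqr_ratio => //; rewrite h3; ring.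
have q4 : (x4 / x2) ^+ 2 = 3%:~R by apply: sqr_ratio => //; rewrite h4; ring.
have [hd _ _ _] := tw; have nb := not_both_squaresP tw.
have nb1 := fun h => nb _ _ _ _ h q3 q4; have nb2 := fun h => nb _ _ _ _ h q0 q3; have nb3 := fun h => nb _ _ _ _ h q0 q4.
move: nb1 nb2 nb3 => {nb}; move: hd; rewrite !inE => /or4P[] /eqP-> n1 n2 n3.
- exact: n1.
- exact: n2.
- exact: n3.
exact: n1.
Qed.

(** Up to scaling the squares would be -3, -1, 1, 3, 5, with independent square roots of -1, 3 and
    5. *)
Lemma no_five_ap_half_centre (K : fieldExtType rat) d (r t x0 x1 x2 x3 x4 D u : K) :
  quadratic_tower d r t -> D != 0 -> five_ap D x0 x1 x2 x3 x4 ->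
  u * D = x2 ^+ 2 -> 2 * u = 1 -> False.
Proof.
move=> tw D0 [h0 h1 h3 h4] hu u2.
have DE : D = 2 * x2 ^+ 2 by rewrite -hu mulrA u2 mul1r.
have x20 : x2 != 0 by apply: contraNneq D0 => e; rewrite DE e expr0n mulr0.
rewrite DE in h0 h1 h3 h4.
have q1 : (x1 / x2) ^+ 2 = (-1)%:~R by apply: sqr_ratio => //; rewrite h1; ring.
have q3 : (x3 / x2) ^+ 2 = 3%:~R by apply: sqr_ratio => //; rewrite h3; ring.
have q4 : (x4 / x2) ^+ 2 = 5%:~R by apply: sqr_ratio => //; rewrite h4; ring.
have [hd _ _ _] := tw; have nb := not_both_squaresP tw.
have nb1 := fun h => nb _ _ _ _ h q3 q4; have nb2 := fun h => nb _ _ _ _ h q1 q4; have nb3 := fun h => nb _ _ _ _ h q1 q3.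
move: nb1 nb2 nb3 => {nb}; move: hd; rewrite !inE => /or4P[] /eqP-> n1 n2 n3.
- exact: n1.
- exact: n2.
- exact: n3.
exact: n3.
Qed.

Lemma one_irrational_coordinate (K : fieldExtType rat) d (r t x0 x1 x2 x3 x4 D : K) :
  quadratic_tower d r t -> D != 0 -> five_ap D x0 x1 x2 x3 x4 ->
  x0 * x1 * x2 * x3 * x4 != 0 ->
  let k := <<1; r>>%AS in
  [/\ x0 * x2 / D \in k, x2 * x4 / D \in k, x0 * x4 / D \in k, x2 ^+ 2 / D \in k &
    (x1 * x2 / D \in k /\ exists2 g, g \in k & x2 * x3 / D = g * t) \/
    (x2 * x3 / D \in k /\ exists2 g, g \in k & x1 * x2 / D = g * t)].
Proof.
move=> tw D0 ap; rewrite !mulf_eq0 !negb_or => /andP[/andP[/andP[/andP[x00 x10] x20] x30] x40] k.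
have [hd hr st _] := tw; have [t2 tk] := st; have [h0 h1 h3 h4] := ap.
pose u := x2 ^+ 2 / D; have hu : u * D = x2 ^+ 2 by rewrite /u divfK.
have [uk [|[e|e]|[c1 c2]]] := five_squares_centre tw D0 h0 h1 h3 h4 hu.
- by move/eqP; rewrite !mulf_eq0 (negPf x00) (negPf x10) (negPf x20) (negPf x30) (negPf x40).
- by case: (no_five_ap_half_centre tw D0 ap hu e).
- have D0' : - D != 0 by rewrite oppr_eq0.
  case: (no_five_ap_half_centre tw D0' (five_ap_rev ap) (u := - u)); first by rewrite mulrNN.
  by rewrite mulrN e opprK.
pose X04 := x0 * x4 / D; pose X13 := x1 * x3 / D; pose X02 := x0 * x2 / D.
pose X24 := x2 * x4 / D; pose X12 := x1 * x2 / D; pose X23 := x2 * x3 / D.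
have u0 : u != 0 by rewrite mulf_neq0 ?invr_neq0 // expf_neq0.
have X130 : X13 != 0 by rewrite !mulf_neq0 ?invr_neq0.
have sq (x y a b : K) : x ^+ 2 = x2 ^+ 2 + a * D -> y ^+ 2 = x2 ^+ 2 + b * D ->
    (x * y / D) ^+ 2 = (u + a) * (u + b).
  move=> hx hy; transitivity (x ^+ 2 * y ^+ 2 / D ^+ 2); first by field.
  by rewrite hx hy -hu; field.
have h0' : x0 ^+ 2 = x2 ^+ 2 + (- 2) * D by rewrite h0; ring.
have h1' : x1 ^+ 2 = x2 ^+ 2 + (- 1) * D by rewrite h1; ring.
have h2' : x2 ^+ 2 = x2 ^+ 2 + 0 * D by ring.
have h3' : x3 ^+ 2 = x2 ^+ 2 + 1 * D by rewrite h3; ring.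
have e13 : X13 ^+ 2 = (u - 1) * (u + 1) := sq _ _ _ _ h1' h3'.
have e04 : X04 ^+ 2 = (u - 2) * (u + 2) := sq _ _ _ _ h0' h4.
have e02 : X02 ^+ 2 = (u - 2) * u by rewrite (sq _ _ _ _ h0' h2'); ring.
have e24 : X24 ^+ 2 = u * (u + 2) by rewrite (sq _ _ _ _ h2' h4); ring.
have e12 : X12 ^+ 2 = (u - 1) * u by rewrite (sq _ _ _ _ h1' h2'); ring.
have e23 : X23 ^+ 2 = u * (u + 1) by rewrite (sq _ _ _ _ h2' h3'); ring.
have X04k : X04 \in k.
  (* The product of the two quantities that change sign is fixed; it is [X04 X13^2 u], and [X13^2]
     and [u] are in [k]. *)
  have -> : X04 = (x0 * x1 * x2 * x3 / D ^+ 2) * (x1 * x2 * x3 * x4 / D ^+ 2) / (X13 ^+ 2 * u).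
    by rewrite /X04 /X13 /u; field; rewrite x10 x20 x30 D0.
  have yy := conjM t2 c1 c2; rewrite mulrNN in yy.
  by apply: rpred_div; [apply: conj_fixed yy | rewrite e13; mem].
have [X13' c13] := tower_conj X13 tw.
have [|e|e] := conj_sqr st c13; first by rewrite e13; mem.
  exfalso; have X13k := conj_unchanged c13 e.
  (* With [X13] in [k], the identities [(u^2 - 2)^2 = (u^2 - 1) (u^2 - 4) + u^2] and [(u^2 + 2)^2 =
     (u^2 - 1) (u^2 - 4) + 9 u^2] give a point over [k] for the differences 1 and 9. *)
  have s1 : ((u ^+ 2 - 2) / u) ^+ 2 = (X04 * X13 / u) ^+ 2 + 1.
    rewrite [in RHS]exprMn exprMn [in RHS]exprMn e13 e04; by field.
  have s2 : ((u ^+ 2 + 2) / u) ^+ 2 = (X04 * X13 / u) ^+ 2 + 9.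
    rewrite [in RHS]exprMn exprMn [in RHS]exprMn e13 e04; by field.
  have yk : X04 * X13 / u \in k by mem.
  have [||z|[z d3]] := zero_or_three19_disc hd hr yk _ _ s1 s2; [by mem | by mem | |].
    by move/eqP: z; rewrite !mulf_eq0 !invr_eq0 (negPf x00) (negPf x40) (negPf D0)
      (negPf x10) (negPf x30) (negPf u0).
  have u4 : (u ^+ 2 - 2) ^+ 2 = (2 * u) ^+ 2.
    apply: (mulIf (expf_neq0 2 (invr_neq0 u0))); rewrite -!exprMn s1 z.
    by field.
  (* The exceptional value makes [rho = u - 1] or [rho = - (u + 1)] a square root of 3, and then
     [X13^2 = u^2 - 1 = 3 + 2 rho]. *)
  have quad : u ^+ 2 = 2 * u + 2 \/ u ^+ 2 = - (2 * u) + 2.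
    by case: (sqr_eqP u4) => <-; [left|right]; ring.
  case: quad => e4.
    apply: (@no_halving_of_three K d r (u - 1) X13 hd hr _ X13k); first by mem.
      by transitivity (u ^+ 2 - 2 * u + 1); [ring | rewrite e4; ring].
    by transitivity (u ^+ 2 - 1); [rewrite e13; ring | rewrite e4; ring].
  apply: (@no_halving_of_three K d r (- (u + 1)) X13 hd hr _ X13k); first by mem.
    by transitivity (u ^+ 2 + 2 * u + 1); [ring | rewrite e4; ring].
  by transitivity (u ^+ 2 - 1); [rewrite e13; ring | rewrite e4; ring].
(* From here on [X13] changes sign, so a factor whose product with [X13] changes sign is itself
   fixed. *)
have anti x y : x * X13 = y -> conjugate k t y (- y) -> x ^+ 2 \in k -> x \in k.
  move=> xy cy x2k; have [x' cx] := tower_conj x tw.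
  have [//|ex|ex] := conj_sqr st cx; first exact: conj_unchanged cx ex.
  have := conj_uniq tk (conjM t2 cx c13); rewrite xy => /(_ _ cy).
  rewrite ex e mulrNN xy => /eqP; rewrite -subr_eq0 opprK -mulr2n -mulr_natl mulf_eq0.
  rewrite (negPf (natK_neq0 K 1)) -xy mulf_eq0 (negPf X130) orbF => /eqP->; mem.
split=> //.
- by apply: (anti X02 _ _ c1); [rewrite /X02 /X13; field | rewrite e02; mem].
- by apply: (anti X24 _ _ c2); [rewrite /X24 /X13; field | rewrite e24; mem].
have [X12' c12] := tower_conj X12 tw; have [X23' c23] := tower_conj X23 tw.
(* [X12 X23] changes sign, hence exactly one of the two factors does. *)
have prod : X12 * X23 = X13 * u by rewrite /X12 /X23 /X13 /u; field.
have prod' : X12' * X23' = - X13 * u.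
  apply: (conj_uniq tk (conjM t2 c12 c23)); rewrite prod; apply: conjM => //.
    by rewrite e in c13.
  exact: conj_mem.
have absurd : X12' * X23' = X12 * X23 -> False.
  rewrite prod prod' mulNr => /eqP; rewrite eq_sym -subr_eq0 opprK -mulr2n -mulr_natl.
  by rewrite (mulf_eq0 2) (mulf_eq0 X13 u) (negPf (natK_neq0 K 1)) (negPf X130) (negPf u0).
have [|g12|g12] := conj_sqr st c12; first by rewrite e12; mem.
  left; split; first exact: conj_unchanged c12 g12.
  have [|g23|g23] := conj_sqr st c23; first by rewrite e23; mem.
    by case: absurd; rewrite g12 g23.
  by rewrite g23 in c23; apply: conj_anti c23.
right; split; last by rewrite g12 in c12; apply: conj_anti c12.
have [|g23|g23] := conj_sqr st c23; first by rewrite e23; mem.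
  exact: conj_unchanged c23 g23.
by case: absurd; rewrite g12 g23 mulrNN.
Qed.

(** Conjugation sends [a] and [b] to themselves or their negatives and fixes the sum: one change of
    sign makes that term 0, two make the sum 0. *)
Lemma sqrt_sum_rational (K : fieldExtType rat) (d : int) (r a b : K) :
  d \in discriminants -> r ^+ 2 = d%:~R -> a \in <<1; r>>%VS -> b \in <<1; r>>%VS ->
  a ^+ 2 \in (1%AS : {subfield K}) -> b ^+ 2 \in (1%AS : {subfield K}) ->
  a + b \in (1%AS : {subfield K}) -> a + b != 0 ->
  a \in (1%AS : {subfield K}) /\ b \in (1%AS : {subfield K}).
Proof.
move=> hd hr ak bk a2 b2 sQ s0; have sr := sqrt_disc hd hr; have [r2 rQ] := sr.
have [a' ca] := @conj_exists K 1%AS r a r2 ak.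
have [b' cb] := @conj_exists K 1%AS r b r2 bk.
have es := conj_uniqF rQ (conjD ca cb) sQ.
suff aQ : a \in (1%AS : {subfield K}).
  by split=> //; rewrite -(addKr a b) addrC rpredB.
case: (conj_sqr sr ca a2) => ea; first exact: conj_unchanged ca ea.
have two x : x = - x -> x = 0 :> K.
  move=> /eqP; rewrite -subr_eq0 opprK -mulr2n -mulr_natl mulf_eq0.
  by rewrite (negPf (natK_neq0 K 1)) => /eqP.
case: (conj_sqr sr cb b2) => eb; rewrite ea eb in es.
  by move/addIr: es => /esym/two->; rewrite rpred0.
by case/eqP: s0; apply: two; rewrite -[LHS]es opprD.
Qed.

(* The squares at positions 0, 1, 2, 4 give the triple [w, w + 2, w + 6], whose curve
   has positive rank over Q but gains no point over Q(i) or Q(sqrt 3). *)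
Lemma rational_coordinates (K : fieldExtType rat) d (r x0 x1 x2 x3 x4 D : K) :
  d = -1 \/ d = 3 -> r ^+ 2 = d%:~R -> D != 0 -> five_ap D x0 x1 x2 x3 x4 -> x2 != 0 ->
  x0 * x2 / D \in <<1; r>>%AS -> x2 * x4 / D \in <<1; r>>%AS ->
  x0 * x4 / D \in <<1; r>>%AS -> x2 ^+ 2 / D \in <<1; r>>%AS -> x1 * x2 / D \in <<1; r>>%AS ->
  [/\ x0 * x2 / D \in (1%AS : {subfield K}), x1 * x2 / D \in (1%AS : {subfield K}),
      x2 ^+ 2 / D \in (1%AS : {subfield K}) & x2 * x4 / D \in (1%AS : {subfield K})].
Proof.
move=> hd13 hr D0 [h0 h1 h3 h4] x20.
have hd : d \in discriminants by case: hd13 => ->.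
set X02 := x0 * x2 / D; set X24 := x2 * x4 / D; set X04 := x0 * x4 / D.
set X12 := x1 * x2 / D; set u := x2 ^+ 2 / D => k02 k24 k04 ku k12.
have u0 : u != 0 by rewrite mulf_neq0 ?invr_neq0 // expf_neq0.
have hu : u * D = x2 ^+ 2 by rewrite /u divfK.
pose X01 := X02 * X12 / u; pose X14 := X12 * X24 / u.
have sq (x y a b : K) : x ^+ 2 = x2 ^+ 2 + a * D -> y ^+ 2 = x2 ^+ 2 + b * D ->
    (x * y / D) ^+ 2 = (u + a) * (u + b).
  move=> hx hy; transitivity (x ^+ 2 * y ^+ 2 / D ^+ 2); first by field.
  by rewrite hx hy -hu; field.
have h0' : x0 ^+ 2 = x2 ^+ 2 + (- 2) * D by rewrite h0; ring.
have h1' : x1 ^+ 2 = x2 ^+ 2 + (- 1) * D by rewrite h1; ring.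
have h2' : x2 ^+ 2 = x2 ^+ 2 + 0 * D by ring.
have e04 : X04 ^+ 2 = (u - 2) * (u + 2) := sq _ _ _ _ h0' h4.
have e02 : X02 ^+ 2 = (u - 2) * u by rewrite (sq _ _ _ _ h0' h2'); ring.
have e24 : X24 ^+ 2 = u * (u + 2) by rewrite (sq _ _ _ _ h2' h4); ring.
have e12 : X12 ^+ 2 = (u - 1) * u by rewrite (sq _ _ _ _ h1' h2'); ring.
have e01 : X01 ^+ 2 = (u - 2) * (u - 1).
  by rewrite /X01 exprMn exprMn e02 e12; field.
have e14 : X14 ^+ 2 = (u - 1) * (u + 2).
  by rewrite /X14 exprMn exprMn e12 e24; field.
pose y := X04 * X12.
have yy1 : X02 * X14 = y by rewrite /X14 /y /X02 /X12 /X24 /u /X04; field; rewrite D0 x20.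
have yy2 : X01 * X24 = y by rewrite /X01 /y /X02 /X12 /X24 /u /X04; field; rewrite D0 x20.
(* The three pairings again, for positions 0, 1, 2, 4: the differences are
   [(x1^2 - x0^2) (x4^2 - x2^2) / D^2 = 2] and [(x2^2 - x0^2) (x4^2 - x1^2) / D^2 = 6]. *)
pose s0 := X04 + X12; pose s1 := X02 + X14; pose s2 := X01 + X24.
have w0 : s0 ^+ 2 = 2 * u ^+ 2 - u - 4 + 2 * y.
  by rewrite /s0 sqrrD e04 e12 -/y; ring.
have w1 : s1 ^+ 2 = s0 ^+ 2 + 2 by rewrite w0 /s1 sqrrD e02 e14 yy1; ring.
have w2 : s2 ^+ 2 = s0 ^+ 2 + 6 by rewrite w0 /s2 sqrrD e01 e24 yy2; ring.
have [||| q0 q1 q2 v0] := @rational_points26 K d r s0 s1 s2 hd13 hr _ _ _ w1 w2.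
- by rewrite /s0; mem.
- by rewrite /s1 /X14; mem.
- by rewrite /s2 /X01; mem.
move: v0; rewrite mulf_eq0 (mulf_eq0 s0) !negb_or => /andP[/andP[s00 s10] s20].
(* Eliminating [y] leaves a quadratic equation for [u] over Q. Its reduced discriminant is [4 (M -
   4) (M - 2) (M + 2) = (2 s0 s1 s2)^2], a rational square, so [u] is rational. *)
pose M := s0 ^+ 2 + 4; have MQ : M \in (1%AS : {subfield K}) by rewrite /M; mem.
have y2 : y ^+ 2 = (u - 2) * (u + 2) * ((u - 1) * u) by rewrite /y exprMn e04 e12.
have eM : M + u - 2 * u ^+ 2 = 2 * y by rewrite /M w0; ring.
have quad : (17 - 4 * M) * u ^+ 2 + 2 * (M - 8) * u + M ^+ 2 = 0.
  transitivity ((M + u - 2 * u ^+ 2) ^+ 2 - 4 * ((u - 2) * (u + 2) * ((u - 1) * u))).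
    by ring.
  by rewrite eM -y2; ring.
have disc : ((17 - 4 * M) * u + (M - 8)) ^+ 2 = (2 * (s0 * s1 * s2)) ^+ 2.
  transitivity ((17 - 4 * M) * ((17 - 4 * M) * u ^+ 2 + 2 * (M - 8) * u + M ^+ 2)
    + ((M - 8) ^+ 2 - M ^+ 2 * (17 - 4 * M))); first by ring.
  rewrite quad !exprMn w1 w2 /M; ring.
have uQ : u \in (1%AS : {subfield K}).
  have [m17|m17] := eqVneq (17 - 4 * M) 0.
    have M0 : 2 * (M - 8) != 0.
      apply/negP => /eqP M8; move/eqP: (natK_neq0 K 14); apply.
      by transitivity (- (17 - 4 * M) - 2 * (2 * (M - 8))); [ring | rewrite m17 M8; ring].
    have -> : u = - M ^+ 2 / (2 * (M - 8)).
      apply: (mulIf M0); rewrite divfK //; apply/eqP; rewrite -subr_eq0 opprK; apply/eqP.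
      by rewrite -[RHS]quad m17; ring.
    by mem.
  suff mu : (17 - 4 * M) * u + (M - 8) \in (1%AS : {subfield K}).
    have -> : u = ((17 - 4 * M) * u + (M - 8) - (M - 8)) / (17 - 4 * M) by field.
    by rewrite rpred_div // ?rpredB //; mem.
  by case: (sqr_eqP disc) => ->; mem.
have [||_ Q12] := sqrt_sum_rational hd hr k04 k12 _ _ q0 s00; [by rewrite e04; mem | by rewrite e12; mem |].
have k14 : X14 \in <<1; r>>%AS by rewrite /X14; mem.
have k01 : X01 \in <<1; r>>%AS by rewrite /X01; mem.
have [||Q02 _] := sqrt_sum_rational hd hr k02 k14 _ _ q1 s10; [by rewrite e02; mem | by rewrite e14; mem |].
have [||_ Q24] := sqrt_sum_rational hd hr k01 k24 _ _ q2 s20; [by rewrite e01; mem | by rewrite e24; mem |].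
by split.
Qed.

(** * Quadratic extensions and their degrees *)

Lemma quadratic_dim (K : fieldExtType rat) (k : {subfield K}) :
  quadratic_over k -> \dim {:K} = (2 * \dim k)%N.
Proof. by move=> q; rewrite (dim_sup_field (subvf k)) q. Qed.

Lemma quadratic_adjoin (K : fieldExtType rat) (k : {subfield K}) (s : K) :
  quadratic_over k -> s \notin k -> <<k; s>>%VS = fullv.
Proof.
move=> q sk; apply/eqP; rewrite eqEdim subvf (quadratic_dim q) dim_Fadjoin leq_mul2r.
have := adjoin_deg_eq1 k s; rewrite (negPf sk) /adjoin_degree.
by case: _.-1 => [|n] //= _; rewrite orbT.
Qed.

Lemma quadratic_sqrt (K : fieldExtType rat) (k : {subfield K}) :
  quadratic_over k -> exists t, sqrt_over k t.
Proof.
move=> q; have /subvPn[y _ yk] : ~~ ({:K} <= k)%VS.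
  by apply/negP => /dimvS; rewrite (quadratic_dim q) leqNgt ltn_Pmull ?adim_gt0.
have deg : adjoin_degree k y = 2%N.
  have := dim_Fadjoin k y; rewrite (quadratic_adjoin q yk) (quadratic_dim q) => /eqP.
  by rewrite eqn_pmul2r ?adim_gt0 // => /eqP.
have sz := size_minPoly k y; rewrite deg in sz.
have /monicP := monic_minPoly k y; rewrite lead_coefE sz /= => lc.
have := minPolyxx k y; rewrite horner_coef sz !big_ord_recr big_ord0 /= lc => e.
have /polyOverP pk := minPolyOver k y.
set b := (minPoly k y)`_1 in e; set c := (minPoly k y)`_0 in e.
have [bk ck] : b \in k /\ c \in k by split; apply: pk.
have n2 := natK_neq0 K 1.
(* Completing the square in the minimal polynomial [X^2 + b X + c] of [y]. *)
exists (y + b / 2); split; last first.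
  apply: contra yk => h; have -> : y = (y + b / 2) - b / 2 by ring.
  by apply: rpredB => //; mem.
have -> : (y + b / 2) ^+ 2 = b ^+ 2 / 4 - c.
  rewrite -[RHS]addr0 -e; by field; rewrite n2 ?(natK_neq0 K 3).
by mem.
Qed.

Lemma dim_sqrt_rational (K : fieldExtType rat) (s : K) :
  s ^+ 2 \in (1%AS : {subfield K}) -> (\dim <<1; s>> <= 2)%N.
Proof.
move=> s2; have -> : \dim <<1; s>> = adjoin_degree (1%AS : {subfield K}) s.
  by rewrite (dim_Fadjoin 1%AS s) dimv1 muln1.
rewrite -ltnS -size_minPoly.
have p0 : 'X^2 - (s ^+ 2)%:P != 0 :> {poly K} by rewrite -size_poly_eq0 size_XnsubC.
rewrite -(size_XnsubC (s ^+ 2) (isT : (0 < 2)%N)); apply: dvdp_leq => //.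
apply: minPoly_dvdp; first by rewrite rpredB ?polyOverXn ?polyOverC.
by rewrite rootE !hornerE subrr.
Qed.

Lemma dim_disc (K : fieldExtType rat) (d : int) (r : K) :
  d \in discriminants -> r ^+ 2 = d%:~R -> \dim <<1; r>> = 2%N.
Proof.
move=> hd hr; have [r2 rQ] := sqrt_disc hd hr.
apply/eqP; rewrite eqn_leq dim_sqrt_rational //= ltnNge; apply: contra rQ => le1.
have : (<<1; r>>%VS <= 1%VS)%VS by rewrite -(geq_leqif (dimv_leqif_sup (subv_adjoin 1%AS r))) dimv1.
by move/subvP; apply; apply: memv_adjoin.
Qed.

(** * Equivalence and classification of progressions *)

Lemma tuple5P (T : Type) (a : 5.-tuple T) :
  exists x0 x1 x2 x3 x4, a = [tuple x0; x1; x2; x3; x4].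
Proof.
case: a => [[|x0 [|x1 [|x2 [|x3 [|x4 [|]]]]]] // sz].
by exists x0, x1, x2, x3, x4; apply: val_inj.
Qed.

Lemma ap_equiv_refl (K : fieldExtType rat) n (u : n.-tuple K) : ap_equiv u u.
Proof. exact: rst_refl. Qed.

Lemma ap_equiv_trans (K : fieldExtType rat) n (u v w : n.-tuple K) :
  ap_equiv u v -> ap_equiv v w -> ap_equiv u w.
Proof. exact: rst_trans. Qed.

Lemma ap_equiv_rev (K : fieldExtType rat) n (u : n.-tuple K) :
  ap_equiv u [tuple of rev u].
Proof. by apply: rst_step; right. Qed.

Lemma ap_equiv_scale (K : fieldExtType rat) n (s : K) (u v : n.-tuple K) :
  s != 0 -> val v = map (fun x => s ^+ 2 * x) u -> ap_equiv u v.
Proof. by move=> s0 e; apply: rst_step; left; exists s => //; apply: val_inj. Qed.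

(** Scalings form a group and commute with reversal, so the generated equivalence collapses to one
    scaling after at most one reversal. *)
Lemma ap_equivP (K : fieldExtType rat) n (u v : n.-tuple K) : ap_equiv u v ->
  exists2 s : K, s != 0 & val v = map (fun x => s ^+ 2 * x) u \/
    val v = map (fun x => s ^+ 2 * x) (rev u).
Proof.
have inv (s : K) (w : seq K) : s != 0 ->
    map (fun x => s^-1 ^+ 2 * x) (map (fun x => s ^+ 2 * x) w) = w.
  move=> s0; rewrite -map_comp map_id_in // => x _ /=.
  by rewrite mulrA -exprMn mulVf // expr1n mul1r.
elim=> {u v} [u v [[s s0 ->]|->]|u|u v _ [s s0 h]|u v w _ [s s0 hs] _ [t t0 ht]].
- by exists s => //; left.
- by exists 1; rewrite ?oner_neq0 //; right; rewrite expr1n (eq_map (@mul1r K)) map_id.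
- by exists 1; rewrite ?oner_neq0 //; left; rewrite expr1n (eq_map (@mul1r K)) map_id.
- exists s^-1; first by rewrite invr_neq0.
  by case: h => ->; [left | right; rewrite -map_rev revK]; rewrite inv.
exists (t * s); first by rewrite mulf_neq0.
have comp (x : seq K) : map (fun x => t ^+ 2 * x) (map (fun x => s ^+ 2 * x) x) =
    map (fun x => (t * s) ^+ 2 * x) x.
  by rewrite -map_comp; apply: eq_map => y /=; ring.
case: hs ht => -> [] ->; rewrite -?map_rev comp ?revK; by [left | right].
Qed.

Lemma properly_defined_equiv (K : fieldExtType rat) n (a b : n.-tuple K) :
  ap_equiv (sqs a) (sqs b) -> properly_defined a -> properly_defined b.
Proof. by move=> ab pa c bc; apply: pa; apply: ap_equiv_trans bc. Qed.

Lemma sqs5 (K : fieldExtType rat) (x0 x1 x2 x3 x4 : K) :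
  sqs [tuple x0; x1; x2; x3; x4] =
  [tuple x0 ^+ 2; x1 ^+ 2; x2 ^+ 2; x3 ^+ 2; x4 ^+ 2].
Proof. exact: val_inj. Qed.

Lemma five_apP (K : fieldExtType rat) (x0 x1 x2 x3 x4 : K) :
  is_ap (sqs [tuple x0; x1; x2; x3; x4]) -> nonconstant (sqs [tuple x0; x1; x2; x3; x4]) ->
  exists2 D, D != 0 & five_ap D x0 x1 x2 x3 x4.
Proof.
rewrite sqs5 => -[D hD] nc; exists D; last first.
  have /= h0 := hD 0%N isT; have /= h1 := hD 1%N isT.
  have /= h2 := hD 2%N isT; have /= h3 := hD 3%N isT.
  have e1 : x1 ^+ 2 = x2 ^+ 2 - D by rewrite -h1; ring.
  have e3 : x3 ^+ 2 = x2 ^+ 2 + D by rewrite -h2; ring.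
  split=> //.
    by transitivity (x1 ^+ 2 - (x1 ^+ 2 - x0 ^+ 2)); [ring | rewrite h0 e1; ring].
  by transitivity (x3 ^+ 2 + (x4 ^+ 2 - x3 ^+ 2)); [ring | rewrite h3 e3; ring].
apply/eqP => D0; case: nc => i [j]; apply.
set u := [tuple _; _; _; _; _] in hD *.
have const m : (m < 5)%N -> u`_m = u`_0.
  by elim: m => // m IH lt; rewrite -IH ?(ltnW lt) //; apply/eqP; rewrite -subr_eq0 hD ?D0.
by rewrite !(tnth_nth 0) !const.
Qed.

Lemma ap_five (K : fieldExtType rat) (D x0 x1 x2 x3 x4 : K) :
  D != 0 -> five_ap D x0 x1 x2 x3 x4 ->
  is_ap (sqs [tuple x0; x1; x2; x3; x4]) /\ nonconstant (sqs [tuple x0; x1; x2; x3; x4]).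
Proof.
move=> D0 [h0 h1 h3 h4]; rewrite sqs5 h0 h1 h3 h4; split.
  by exists D; case=> [|[|[|[|m]]]] //= _; ring.
exists (inord 2), (inord 3); rewrite !(tnth_nth 0) !inordK //= => e.
by case/eqP: D0; apply: (addrI (x2 ^+ 2)); rewrite addr0.
Qed.

(** The outcome from which [alpha = t^2] arises. The condition on [d] records that over Q(i) and
    Q(sqrt 3) it is incompatible with being properly defined. *)
Definition irrational_fourth (K : fieldExtType rat) (d : int) (r t : K) (u : 5.-tuple K) :=
  (d = 2 \/ d = -2) /\
  exists2 c : 5.-tuple K, ap_equiv u (sqs c) & of_form <<1; r>>%AS (t ^+ 2) (sqs c).

Lemma irrational_fourthP (K : fieldExtType rat) d (r t x0 x1 x2 x3 x4 D : K) (b : 5.-tuple K) :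
  quadratic_tower d r t -> quadratic_over <<1; r>>%AS -> properly_defined b ->
  ap_equiv (sqs b) (sqs [tuple x0; x1; x2; x3; x4]) ->
  D != 0 -> five_ap D x0 x1 x2 x3 x4 -> x2 != 0 ->
  let k := <<1; r>>%AS in
  x0 * x2 / D \in k -> x2 * x4 / D \in k -> x0 * x4 / D \in k -> x2 ^+ 2 / D \in k ->
  x1 * x2 / D \in k -> (exists2 g, g \in k & x2 * x3 / D = g * t) ->
  irrational_fourth d r t (sqs b).
Proof.
move=> tw q pb bx D0 ap x20 k k02 k24 k04 ku k12 [g gk eg].
have [hd hr st full] := tw; have [h0 h1 h3 h4] := ap.
(* Scaling by [(x2 / D)^2] turns each root [x_j] into [x_j x2 / D]; all of these except the fourth
   lie in [k]. *)
pose c := [tuple x0 * x2 / D; x1 * x2 / D; x2 ^+ 2 / D; x2 * x3 / D; x2 * x4 / D].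
have bc : ap_equiv (sqs b) (sqs c).
  apply: ap_equiv_trans bx _; apply: (ap_equiv_scale (s := x2 / D)).
    by rewrite mulf_neq0 ?invr_neq0.
  by rewrite /=; congr [:: _; _; _; _; _]; field.
split; last first.
  exists c => //; exists (x0 * x2 / D), (x1 * x2 / D), (x2 ^+ 2 / D), g, (x2 * x4 / D).
  by split=> //; rewrite sqs5; apply: val_inj => /=; rewrite eg; congr [:: _; _; _; _; _]; ring.
have [d2|hd13] : (d = 2 \/ d = -2) \/ (d = -1 \/ d = 3).
  by move: hd; rewrite !inE => /or4P[] /eqP->; [right; left | right; right | left; left | left; right].
  by [].
(* Four scaled roots are rational and the fifth has a rational square, so they lie in a field of
   degree at most 2, whereas [K] has degree 4. *)
exfalso; have [Q02 Q12 uQ Q24] := rational_coordinates hd13 hr D0 ap x20 k02 k24 k04 ku k12.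
have Q23 : (x2 * x3 / D) ^+ 2 \in (1%AS : {subfield K}).
  have -> : (x2 * x3 / D) ^+ 2 = x2 ^+ 2 / D * (x2 ^+ 2 / D + 1).
    transitivity (x2 ^+ 2 * x3 ^+ 2 / D ^+ 2); first by field.
    by rewrite h3; field.
  by mem.
have := dim_sqrt_rational Q23.
have sub1 := subvP (sub1v <<1; x2 * x3 / D>>%AS).
rewrite (pb c bc <<1; x2 * x3 / D>>%AS).
  by rewrite (quadratic_dim q) [\dim _](dim_disc hd hr).
move=> z; rewrite !inE => /or4P[/eqP->|/eqP->|/eqP->|/orP[] /eqP->]; try exact: sub1.
exact: memv_adjoin.
Qed.

Lemma tower_classification (K : fieldExtType rat) d (r t : K) (b : 5.-tuple K) :
  quadratic_tower d r t -> quadratic_over <<1; r>>%AS -> nc_proper_ap b ->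
  [\/ ap_equiv (sqs b) [tuple (-2 : K); -1; 0; 1; 2] /\
        ((exists s : K, s ^+ 2 = -1) /\ (exists s : K, s ^+ 2 = 2)),
      ap_equiv (sqs b) [tuple (0 : K); 1; 2; 3; 4] /\
        ((exists s : K, s ^+ 2 = 2) /\ (exists s : K, s ^+ 2 = 3))
    | irrational_fourth d r t (sqs b)].
Proof.
move=> tw q [bap bnc pb]; have [x0 [x1 [x2 [x3 [x4 eb]]]]] := tuple5P b.
move: (bap) (bnc); rewrite eb => /five_apP H /H{H}[D D0 ap].
have D0' : - D != 0 by rewrite oppr_eq0.
have ap' := five_ap_rev ap.
have [h0 h1 h3 h4] := ap.
have x10 := no_five_ap_second_zero tw D0 ap; have x30 := no_five_ap_second_zero tw D0' ap'.
have first_zero y0 y1 y2 y3 y4 E : E != 0 -> five_ap E y0 y1 y2 y3 y4 -> y1 != 0 -> y0 = 0 ->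
    ap_equiv (sqs [tuple y0; y1; y2; y3; y4]) [tuple (0 : K); 1; 2; 3; 4] /\
        ((exists s : K, s ^+ 2 = 2) /\ (exists s : K, s ^+ 2 = 3)).
  move=> E0 [g0 g1 g3 g4] y10 y00.
  have y2E : y2 ^+ 2 = 2 * y1 ^+ 2.
    apply/eqP; rewrite -subr_eq0; apply/eqP; rewrite g1.
    by transitivity (- (y2 ^+ 2 - 2 * E)); [ring | rewrite -g0 y00; ring].
  have y1E : E = y1 ^+ 2 by transitivity (y2 ^+ 2 - y1 ^+ 2); [rewrite g1; ring | rewrite y2E; ring].
  split; last split.
  - apply: (ap_equiv_scale (s := y1^-1)); first by rewrite invr_neq0.
    by rewrite /= g3 g4 y2E y1E y00; congr [:: _; _; _; _; _]; field.
  - by exists (y2 / y1); rewrite exprMn y2E exprVn mulfK // expf_neq0.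
  exists (y3 / y1); rewrite exprMn g3 y2E y1E; by field.
have revE (y0 y1 y2 y3 y4 : K) : [tuple of rev (sqs [tuple y0; y1; y2; y3; y4])] =
    sqs [tuple y4; y3; y2; y1; y0] by apply: val_inj.
have [x20|x20] := eqVneq x2 0.
  constructor 1; rewrite x20 expr0n /= in h0 h1 h3 h4.
  split; last split.
  - apply: (ap_equiv_scale (s := x3^-1)); first by rewrite invr_neq0.
    by rewrite /= h0 h1 x20 h4 exprVn h3; congr [:: _; _; _; _; _]; field.
  - by exists (x1 / x3); rewrite exprMn exprVn h1 h3; field.
  by exists (x4 / x3); rewrite exprMn exprVn h4 h3; field.
have [x00|x00] := eqVneq x0 0; first by constructor 2; exact: (first_zero _ _ _ _ _ _ D0 ap x10 x00).
have [x40|x40] := eqVneq x4 0.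
  constructor 2; have [e s] := first_zero _ _ _ _ _ _ D0' ap' x30 x40; split=> //.
  by apply: ap_equiv_trans (ap_equiv_rev _) _; rewrite revE.
have nz : x0 * x1 * x2 * x3 * x4 != 0 by rewrite !mulf_neq0.
have [k02 k24 k04 ku [[k12 g]|[k23 g]]] := one_irrational_coordinate tw D0 ap nz.
  constructor 3; rewrite -eb.
  apply: (irrational_fourthP tw q pb _ D0 ap x20 k02 k24 k04 ku k12 g).
  by rewrite eb; apply: ap_equiv_refl.
constructor 3; rewrite -eb.
(* An irrational second term: reversal makes it the fourth and replaces [D] by [-D]. *)
have neg (x y : K) : x * y / (- D) = - (y * x / D) by rewrite invrN mulrN (mulrC x).
apply: (irrational_fourthP tw q pb _ D0' ap' x20); rewrite ?expr2 ?neg ?rpredN -?expr2 //.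
  by apply: ap_equiv_trans (ap_equiv_rev _) _; rewrite eb revE; apply: ap_equiv_refl.
by case: g => z zk ez; exists (- z); rewrite ?rpredN // ez mulNr.
Qed.

(** * Square-free generators *)

(** Carried over to [algC], the element is a rational algebraic integer, hence an integer. *)
Lemma rational_integral (K : fieldExtType rat) (x : K) :
  x \in (1%AS : {subfield K}) -> integralOver (intr : int -> K) x ->
  exists z : int, x = z%:~R.
Proof.
case/mem_ratP=> q -> [p pm rp].
have rq : root (map_poly intr p : {poly rat}) q.
  rewrite -(fmorph_root (of_rat K)) -map_poly_comp.
  by rewrite (eq_map_poly (g := intr)) // => z /=; rewrite of_ratE.
have Aq : (ratr q : algC) \in Aint.
  apply: (@root_monic_Aint (map_poly intr p)).
  - move: rq; rewrite -(fmorph_root (@ratr algC)) -map_poly_comp.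
    by rewrite (eq_map_poly (g := intr)) // => z /=; rewrite ratr_int.
  - exact: monic_map.
  - by apply/polyOverP => i; rewrite coef_map /= intr_int.
have /intrP[z qz] : q \is a Num.int by rewrite -Cint_rat Cint_rat_Aint ?Crat_rat.
by exists z; rewrite qz of_ratE.
Qed.

Lemma conj_integral (K : fieldExtType rat) (d : int) (r x y : K) :
  d \in discriminants -> r ^+ 2 = d%:~R -> conjugate 1%AS r x y ->
  integralOver (intr : int -> K) x -> integralOver (intr : int -> K) y.
Proof.
move=> hd hr c [p pm /rootP px]; exists p => //; apply/rootP.
have [r2 rQ] := sqrt_disc hd hr.
have cp : conjugate 1%AS r (map_poly intr p).[x] (map_poly intr p).[y].
  rewrite !horner_coef; apply: (big_ind2 (conjugate 1%AS r)).
  - by apply: conj_mem; mem.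
  - by move=> x1 x2 y1 y2; apply: conjD.
  move=> i _; apply: conjM => //; last by apply: conjX.
  by apply: (@conj_mem _ _ r); rewrite coef_map /=; mem.
by rewrite -px; apply: (conj_uniqF rQ cp); rewrite px; mem.
Qed.

Lemma integer_norm (K : fieldExtType rat) (d : int) (r x : K) :
  d \in discriminants -> r ^+ 2 = d%:~R -> is_integer_of <<1; r>>%AS x ->
  exists x' (m : int), [/\ conjugate 1%AS r x x', is_integer_of <<1; r>>%AS x'
    & x * x' = m%:~R].
Proof.
move=> hd hr [xk xi]; have [r2 rQ] := sqrt_disc hd hr.
have [x' cx] := @conj_exists K 1%AS r x r2 xk.
have xi' := conj_integral hd hr cx xi.
have xxQ : x * x' \in (1%AS : {subfield K}).
  by apply: (conj_fixed (t := r)); rewrite {2}mulrC; apply: conjM => //; apply: conjC.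
have [m em] := rational_integral xxQ (integral_mul xi xi').
exists x', m; split=> //; split=> //.
have [a [b [aQ bQ _ ->]]] := cx; have sub1 := subvP (sub1v <<1; r>>%AS).
have ak : a \in <<1; r>>%AS by apply: sub1.
have bk : b \in <<1; r>>%AS by apply: sub1.
have rk : r \in <<1; r>>%AS by apply: memv_adjoin.
by mem.
Qed.

Lemma sqrt_overZ (K : fieldExtType rat) (k : {subfield K}) (a t : K) :
  a \in k -> a != 0 -> sqrt_over k t -> sqrt_over k (a * t).
Proof.
move=> ak a0 [t2 tk]; split; first by rewrite exprMn; mem.
by apply: contra tk => h; rewrite -(mulKf a0 t); mem.
Qed.

(* A generator [t ^+ 2] of least absolute norm is square-free. *)
Lemma squarefree_generator (K : fieldExtType rat) (d : int) (r : K) :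
  d \in discriminants -> r ^+ 2 = d%:~R -> quadratic_over <<1; r>>%AS ->
  exists2 t, sqrt_over <<1; r>>%AS t & squarefree_in <<1; r>>%AS (t ^+ 2).
Proof.
move=> hd hr q; set k := <<1; r>>%AS; apply: NNPP => none.
have [r2 rQ] := sqrt_disc hd hr; have sub1 := subvP (sub1v k).
pose P (n : nat) := exists t x', [/\ sqrt_over k t, is_integer_of k (t ^+ 2),
  conjugate 1%AS r (t ^+ 2) x' & exists2 m : int, t ^+ 2 * x' = m%:~R & `|m|%N = n].
have noP n : ~ P n.
  elim/ltn_ind: n => n IH [t [x' [st ti cx [m em mn]]]].
  apply: none; exists t => //; split=> // y z yi zi tyz.
  have [y' [a [cy yi' ea]]] := integer_norm hd hr yi.
  have [z' [b [cz zi' eb]]] := integer_norm hd hr zi.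
  have t0 := sqrt_over_neq0 st.
  have mE : m = a ^+ 2 * b.
    apply/eqP; rewrite -(eqr_int (rat)); apply/eqP; apply: (@of_rat_inj K).
    rewrite !of_ratE rmorphM rmorphXn /= -em -ea -eb tyz.
    suff -> : x' = y' ^+ 2 * z' by ring.
    by apply: (conj_uniq rQ cx); rewrite tyz; apply: conjM => //; apply: conjX.
  have y0 : y != 0 by apply: contraNneq t0 => y0; rewrite -sqrf_eq0 tyz y0 expr0n mul0r.
  have a0 : a != 0.
    have yy0 := conj_neq0 rQ cy y0.
    by apply: contraNneq (mulf_neq0 y0 yy0) => a0; rewrite ea a0.
  have z0 : z != 0 by apply: contraNneq t0 => z0; rewrite -sqrf_eq0 tyz z0 mulr0.
  have b0 : b != 0.
    have zz0 := conj_neq0 rQ cz z0.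
    by apply: contraNneq (mulf_neq0 z0 zz0) => b0; rewrite eb b0.
  (* [a] is the norm of [y]. If it is 1 or -1, the conjugate of [y] is its inverse up to sign;
     otherwise [t / y] has square [z], whose norm [b] is smaller than [m = a^2 b] in absolute
     value. *)
  have [a1|a1] : (a = 1 \/ a = -1) \/ (1 < `|a|)%N by lia.
    case: a1 => a1; first by exists y'; rewrite // ea a1.
    exists (- y'); first by case: yi' => h1 h2; split; [mem | apply: integral_opp].
    by rewrite mulrN ea a1 rmorphN opprK.
  exfalso; apply: (IH `|b|%N).
    by rewrite -mn mE abszM abszX; move: a1 b0; rewrite -absz_gt0; nia.
  have yk : y^-1 \in k by case: yi => h _; mem.
  have tz : (y^-1 * t) ^+ 2 = z by rewrite exprMn tyz exprVn mulKf // expf_neq0.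
  exists (y^-1 * t), z'; rewrite tz; split=> //; last by exists b.
  by apply: sqrt_overZ; rewrite ?invr_eq0.
have [t st] := quadratic_sqrt q.
have [t2 tk] := st.
have [a [b [aQ bQ e]]] := adjoin_sqrtP r2 t2.
case/mem_ratP: aQ => a' ea; case/mem_ratP: bQ => b' eb.
(* Denominators are cleared with a square factor, so that [N^2 t^2] is integral and still generates
   the same extension. *)
pose N := denq a' * denq b'.
have N0 : N%:~R != 0 :> K.
  by rewrite -[N%:~R](of_ratE K).1.2 fmorph_eq0 intr_eq0 mulf_neq0 ?denq_neq0.
have stN : sqrt_over k (N%:~R * t) by apply: sqrt_overZ => //; mem.
have int_intr (z : int) : integralOver (intr : int -> K) z%:~R by apply: integral_id.
have ri : integralOver (intr : int -> K) r.
  exists ('X^2 - d%:P); first by rewrite monicXnsubC.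
  by rewrite rmorphB /= map_polyXn map_polyC rootE !hornerE hr subrr.
have ti : is_integer_of k ((N%:~R * t) ^+ 2).
  split; first by case: stN.
  have -> : (N%:~R * t) ^+ 2 = (N * numq a' * denq b')%:~R + (N * numq b' * denq a')%:~R * r.
    have fa (c : rat) : of_rat K c * (denq c)%:~R = (numq c)%:~R.
      have ec : c * (denq c)%:~R = (numq c)%:~R.
        by rewrite -{1}[c]divq_num_den divfK // intr_eq0 denq_neq0.
      by have := congr1 (of_rat K) ec; rewrite !of_ratE.
    by rewrite exprMn e ea eb /N !rmorphM /= -!fa; ring.
  exact: (integral_add (int_intr _) (integral_mul (int_intr _) ri)).
have [x' [m [cx _ em]]] := integer_norm hd hr ti.
by apply: (noP `|m|%N); exists (N%:~R * t), x'; split=> //; exists m.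
Qed.

(** * The four base fields *)

Lemma ap_equiv_ap (K : fieldExtType rat) (u v : 5.-tuple K) :
  ap_equiv u v -> is_ap u /\ nonconstant u -> is_ap v /\ nonconstant v.
Proof.
have transfer (w : 5.-tuple K) (f : 'I_5 -> 'I_5) (s : K) : s != 0 -> involutive f ->
    (forall j, tnth v j = s ^+ 2 * tnth w (f j)) -> nonconstant w -> nonconstant v.
  move=> s0 fK h [j [l jl]]; exists (f j), (f l); rewrite !h !fK.
  by move/(mulfI (expf_neq0 2 s0)).
case: (tuple5P u) => x0 [x1 [x2 [x3 [x4 eu]]]] /ap_equivP[s s0 hv] [[D hD] nc].
have /= h0 := hD 0%N isT; have /= h1 := hD 1%N isT.
have /= h2 := hD 2%N isT; have /= h3 := hD 3%N isT.
rewrite eu /= in h0 h1 h2 h3.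
case: hv => ev; split.
- exists (s ^+ 2 * D); rewrite ev eu.
  by case=> [|[|[|[|m]]]] //= _; rewrite -mulrBr ?h0 ?h1 ?h2 ?h3.
- apply: (transfer u id s) => // j; rewrite !(tnth_nth 0) ev.
  by rewrite (nth_map 0) // size_tuple.
- exists (- (s ^+ 2 * D)); rewrite ev eu /=.
  by case=> [|[|[|[|m]]]] //= _; rewrite -mulrBr -opprB ?h0 ?h1 ?h2 ?h3 mulrN.
apply: (transfer u (@rev_ord 5) s) => //; first exact: rev_ordK.
move=> j; rewrite !(tnth_nth 0) ev (nth_map 0) ?size_rev ?size_tuple //.
by rewrite nth_rev ?size_tuple.
Qed.

Lemma sqrt_mem (K : fieldExtType rat) (L : {subfield K}) (x y z s : K) :
  x \in L -> y \in L -> y != 0 -> x ^+ 2 = z * y ^+ 2 -> s ^+ 2 = z -> s \in L.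
Proof.
move=> xL yL y0 e sz; have : s ^+ 2 = (x / y) ^+ 2.
  by rewrite exprMn exprVn e mulfK ?expf_neq0.
by case/sqr_eqP=> ->; mem.
Qed.

(** Scaling preserves ratios of terms and reversal only permutes them, so in every equivalent
    progression quotients of the roots are square roots of -1 and 2; a subfield containing the roots
    therefore contains [i] and [s]. *)
Lemma sym_ap_exists (K : fieldExtType rat) (i s : K) : i ^+ 2 = -1 -> s ^+ 2 = 2 ->
  (forall L : {subfield K}, i \in L -> s \in L -> (L : {vspace K}) = fullv) ->
  exists2 a : 5.-tuple K, nc_proper_ap a & sqs a = [tuple (-2 : K); -1; 0; 1; 2].
Proof.
move=> hi hs gen; have ea : sqs [tuple i * s; i; 0; 1; s] = [tuple (-2 : K); -1; 0; 1; 2].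
  rewrite sqs5; apply: val_inj => /=.
  by rewrite exprMn hi hs expr0n expr1n mulN1r.
exists [tuple i * s; i; 0; 1; s] => //.
have [||h1 h2] := @ap_five K 1 (i * s) i 0 1 s; first exact: oner_neq0.
  by split; rewrite ?exprMn ?hi ?hs ?expr1n ?expr0n /=; ring.
split=> // b; rewrite ea; have [y0 [y1 [y2 [y3 [y4 ->]]]]] := tuple5P b.
rewrite sqs5 => /ap_equivP[c c0 h] L yL; apply: gen;
  case: h => -[e0 e1 _ e3 e4].
- have y30 : y3 != 0 by rewrite -sqrf_eq0 e3 mulr1 sqrf_eq0.
  apply: (sqrt_mem (x := y1) (y := y3) _ _ y30 _ hi); try by apply: yL; rewrite !inE eqxx ?orbT.
  by rewrite e1 e3; ring.
- have y10 : y1 != 0 by rewrite -sqrf_eq0 e1 mulr1 sqrf_eq0.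
  apply: (sqrt_mem (x := y3) (y := y1) _ _ y10 _ hi); try by apply: yL; rewrite !inE eqxx ?orbT.
  by rewrite e1 e3; ring.
- have y30 : y3 != 0 by rewrite -sqrf_eq0 e3 mulr1 sqrf_eq0.
  apply: (sqrt_mem (x := y4) (y := y3) _ _ y30 _ hs); try by apply: yL; rewrite !inE eqxx ?orbT.
  by rewrite e3 e4; ring.
have y10 : y1 != 0 by rewrite -sqrf_eq0 e1 mulr1 sqrf_eq0.
apply: (sqrt_mem (x := y0) (y := y1) _ _ y10 _ hs); try by apply: yL; rewrite !inE eqxx ?orbT.
by rewrite e0 e1; ring.
Qed.

Lemma zero_ap_exists (K : fieldExtType rat) (i s : K) : i ^+ 2 = 3 -> s ^+ 2 = 2 ->
  (forall L : {subfield K}, i \in L -> s \in L -> (L : {vspace K}) = fullv) ->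
  exists2 a : 5.-tuple K, nc_proper_ap a & sqs a = [tuple (0 : K); 1; 2; 3; 4].
Proof.
move=> hi hs gen; have ea : sqs [tuple 0; 1; s; i; 2] = [tuple (0 : K); 1; 2; 3; 4].
  rewrite sqs5; apply: val_inj => /=.
  by rewrite hi hs expr0n expr1n; congr [:: _; _; _; _; _]; ring.
exists [tuple 0; 1; s; i; 2] => //.
have [||h1 h2] := @ap_five K 1 0 1 s i 2; first exact: oner_neq0.
  by split; rewrite ?hi ?hs ?expr1n ?expr0n /=; ring.
split=> // b; rewrite ea; have [y0 [y1 [y2 [y3 [y4 ->]]]]] := tuple5P b.
rewrite sqs5 => /ap_equivP[c c0 h] L yL; apply: gen;
  case: h => -[e0 e1 e2 e3 e4].
- have y10 : y1 != 0 by rewrite -sqrf_eq0 e1 mulr1 sqrf_eq0.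
  apply: (sqrt_mem (x := y3) (y := y1) _ _ y10 _ hi); try by apply: yL; rewrite !inE eqxx ?orbT.
  by rewrite e1 e3; ring.
- have y30 : y3 != 0 by rewrite -sqrf_eq0 e3 mulr1 sqrf_eq0.
  apply: (sqrt_mem (x := y1) (y := y3) _ _ y30 _ hi); try by apply: yL; rewrite !inE eqxx ?orbT.
  by rewrite e1 e3; ring.
- have y10 : y1 != 0 by rewrite -sqrf_eq0 e1 mulr1 sqrf_eq0.
  apply: (sqrt_mem (x := y2) (y := y1) _ _ y10 _ hs); try by apply: yL; rewrite !inE eqxx ?orbT.
  by rewrite e2 e1; ring.
have y30 : y3 != 0 by rewrite -sqrf_eq0 e3 mulr1 sqrf_eq0.
apply: (sqrt_mem (x := y2) (y := y3) _ _ y30 _ hs); try by apply: yL; rewrite !inE eqxx ?orbT.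
by rewrite e2 e3; ring.
Qed.

Lemma generated_by (K : fieldExtType rat) (r s : K) (L : {subfield K}) :
  <<<<1; r>>; s>>%VS = fullv -> r \in L -> s \in L -> (L : {vspace K}) = fullv.
Proof.
move=> full rL sL; apply/eqP; rewrite eqEsubv subvf -full.
by apply/FadjoinP; split=> //; apply/FadjoinP; split=> //; apply: sub1v.
Qed.

Lemma full_notin (K : fieldExtType rat) (k : {subfield K}) (s : K) :
  quadratic_over k -> <<k; s>>%VS = fullv -> s \notin k.
Proof.
move=> q full; apply/negP => /Fadjoin_idP ks; have := quadratic_dim q.
by rewrite -full ks => /eqP; rewrite -{1}[\dim k]mul1n eqn_pmul2r ?adim_gt0.
Qed.

Lemma int_sqr_adjoin (K : fieldExtType rat) (d z : int) (r s : K) :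
  d \in discriminants -> r ^+ 2 = d%:~R -> quadratic_over <<1; r>>%AS ->
  s ^+ 2 = z%:~R -> small_nonsquare z -> small_nonsquare (z * d) ->
  s \notin <<1; r>>%AS /\ <<<<1; r>>; s>>%VS = fullv.
Proof.
move=> hd hr q hs nz nzd; suff sk : s \notin <<1; r>>%AS.
  by split=> //; apply: quadratic_adjoin.
by apply/negP => sk; apply: (int_sqr_in_disc_field hd hr sk hs).
Qed.

(** [K] has degree 4 over Q, so it is quadratic over each of its quadratic subfields. *)
Lemma disc_quadratic (K : fieldExtType rat) (d e : int) (r s : K) :
  d \in discriminants -> e \in discriminants -> r ^+ 2 = d%:~R -> s ^+ 2 = e%:~R ->
  quadratic_over <<1; r>>%AS -> quadratic_over <<1; s>>%AS.
Proof.
move=> hd he hr hs q; have := quadratic_dim q.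
rewrite [\dim <<1; r>>](dim_disc hd hr) /quadratic_over => ->.
by rewrite [\dim <<1; s>>](dim_disc he hs).
Qed.

Lemma tower_of_sqrt (K : fieldExtType rat) (d : int) (r t : K) :
  d \in discriminants -> r ^+ 2 = d%:~R -> quadratic_over <<1; r>>%AS ->
  sqrt_over <<1; r>>%AS t -> quadratic_tower d r t.
Proof. by move=> hd hr q st; split=> //; apply: quadratic_adjoin; case: st. Qed.

Lemma five_squares_over_i (K : fieldExtType rat) (r : K) : r ^+ 2 = -1 ->
  let k : {subfield K} := <<1; r>>%AS in
  quadratic_over k ->
  ((exists a : 5.-tuple K, nc_proper_ap a) <-> is_adjoin_sqrt k 2)
  /\ (is_adjoin_sqrt k 2 -> unique_nc_proper_ap [tuple (-2 : K); -1; 0; 1; 2]).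
Proof.
move=> hr k q; have hd : -1 \in discriminants by [].
have hr' : r ^+ 2 = (-1)%:~R by rewrite hr.
have [t st] := quadratic_sqrt q; have tw := tower_of_sqrt hd hr' q st.
have cl (b : 5.-tuple K) : nc_proper_ap b ->
    ap_equiv (sqs b) [tuple (-2 : K); -1; 0; 1; 2] /\ exists s : K, s ^+ 2 = 2.
  case/(tower_classification tw q) => [[e [_ hs]]|[_ [[s hs] [i hi]]]|[[]]] //.
  by case: (@not_both_squaresP _ _ 2 3 _ _ s i tw).
have ex : is_adjoin_sqrt k 2 -> unique_nc_proper_ap [tuple (-2 : K); -1; 0; 1; 2].
  case=> s hs full; split; last by move=> b /cl[].
  by apply: (sym_ap_exists hr hs) => L; apply: generated_by.
split=> //; split=> [[b /cl[_ [s hs]]]|/ex[[a na _] _]]; last by exists a.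
by exists s => //; case: (@int_sqr_adjoin _ _ 2 _ s hd hr' q).
Qed.

Lemma five_squares_over_sqrt3 (K : fieldExtType rat) (r : K) : r ^+ 2 = 3 ->
  let k : {subfield K} := <<1; r>>%AS in
  quadratic_over k ->
  ((exists a : 5.-tuple K, nc_proper_ap a) <-> is_adjoin_sqrt k 2)
  /\ (is_adjoin_sqrt k 2 -> unique_nc_proper_ap [tuple (0 : K); 1; 2; 3; 4]).
Proof.
move=> hr k q; have hd : 3 \in discriminants by [].
have hr' : r ^+ 2 = 3%:~R by rewrite hr.
have [t st] := quadratic_sqrt q; have tw := tower_of_sqrt hd hr' q st.
have cl (b : 5.-tuple K) : nc_proper_ap b ->
    ap_equiv (sqs b) [tuple (0 : K); 1; 2; 3; 4] /\ exists s : K, s ^+ 2 = 2.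
  case/(tower_classification tw q) => [[_ [[i hi] [s hs]]]|[e [hs _]]|[[]]] //.
  by case: (@not_both_squaresP _ _ (-1) 2 _ _ i s tw).
have ex : is_adjoin_sqrt k 2 -> unique_nc_proper_ap [tuple (0 : K); 1; 2; 3; 4].
  case=> s hs full; split; last by move=> b /cl[].
  by apply: (zero_ap_exists hr hs) => L; apply: generated_by.
split=> //; split=> [[b /cl[_ [s hs]]]|/ex[[a na _] _]]; last by exists a.
by exists s => //; case: (@int_sqr_adjoin _ _ 2 _ s hd hr' q).
Qed.

(** The hypothesis ranges over all [t] so that a generator with square-free [t^2] can be
    inserted. *)
Lemma irrational_fourth_alpha (K : fieldExtType rat) (d : int) (r : K) :
  d \in discriminants -> r ^+ 2 = d%:~R -> quadratic_over <<1; r>>%AS ->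
  (exists2 b : 5.-tuple K, nc_proper_ap b &
     forall t, quadratic_tower d r t -> irrational_fourth d r t (sqs b)) ->
  alpha_case <<1; r>>%AS.
Proof.
move=> hd hr q [b nb fl]; have [t st sf] := squarefree_generator hd hr q.
have tw := tower_of_sqrt hd hr q st; have [_ [c bc form]] := fl t tw.
exists (t ^+ 2); split=> //; first by exists t => //; case: tw.
exists c => //; have [bap bnc pb] := nb; have [cap cnc] := ap_equiv_ap bc (conj bap bnc).
by split=> //; apply: properly_defined_equiv bc pb.
Qed.

(* [K] is also a quadratic extension of [Q(i)], where no irrational fourth square occurs. *)
Lemma unique_over_i (K : fieldExtType rat) (d : int) (r i : K) :
  d \in discriminants -> r ^+ 2 = d%:~R -> quadratic_over <<1; r>>%AS -> i ^+ 2 = -1 ->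
  (exists s : K, s ^+ 2 = 2) -> unique_nc_proper_ap [tuple (-2 : K); -1; 0; 1; 2].
Proof.
move=> hd hr q hi [s hs]; have hdi : -1 \in discriminants by [].
have hi' : i ^+ 2 = (-1)%:~R by rewrite hi.
have qi := disc_quadratic hd hdi hr hi' q; have [_ H] := five_squares_over_i hi qi.
by apply: H; exists s => //; case: (@int_sqr_adjoin _ _ 2 _ s hdi hi' qi).
Qed.

Lemma unique_over_sqrt3 (K : fieldExtType rat) (d : int) (r i : K) :
  d \in discriminants -> r ^+ 2 = d%:~R -> quadratic_over <<1; r>>%AS -> i ^+ 2 = 3 ->
  (exists s : K, s ^+ 2 = 2) -> unique_nc_proper_ap [tuple (0 : K); 1; 2; 3; 4].
Proof.
move=> hd hr q hi [s hs]; have hdi : 3 \in discriminants by [].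
have hi' : i ^+ 2 = 3%:~R by rewrite hi.
have qi := disc_quadratic hd hdi hr hi' q; have [_ H] := five_squares_over_sqrt3 hi qi.
by apply: H; exists s => //; case: (@int_sqr_adjoin _ _ 2 _ s hdi hi' qi).
Qed.

Lemma five_squares_over_sqrt2 (K : fieldExtType rat) (r : K) : r ^+ 2 = 2 ->
  let k : {subfield K} := <<1; r>>%AS in
  quadratic_over k ->
  ((exists a : 5.-tuple K, nc_proper_ap a) <->
     [\/ is_adjoin_sqrt k 3, is_adjoin_sqrt k (-1) | alpha_case k])
  /\ (is_adjoin_sqrt k 3 -> unique_nc_proper_ap [tuple (0 : K); 1; 2; 3; 4])
  /\ (is_adjoin_sqrt k (-1) ->
        unique_nc_proper_ap [tuple (-2 : K); -1; 0; 1; 2])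
  /\ (~ is_adjoin_sqrt k 3 -> ~ is_adjoin_sqrt k (-1) -> alpha_form k).
Proof.
move=> hr k q; have hd : 2 \in discriminants by [].
have hr' : r ^+ 2 = 2%:~R by rewrite hr.
have cl (t : K) (b : 5.-tuple K) : quadratic_tower 2 r t -> nc_proper_ap b ->
    [\/ is_adjoin_sqrt k 3, is_adjoin_sqrt k (-1) | irrational_fourth 2 r t (sqs b)].
  move=> tw /(tower_classification tw q)[[_ [[i hi] _]]|[_ [_ [i hi]]]|fl].
  - constructor 2; exists i => //.
    by case: (@int_sqr_adjoin _ _ (-1) _ i hd hr' q); rewrite // hi.
  - constructor 1; exists i => //.
    by case: (@int_sqr_adjoin _ _ 3 _ i hd hr' q); rewrite // hi.
  by constructor 3.
have u3 : is_adjoin_sqrt k 3 -> unique_nc_proper_ap [tuple (0 : K); 1; 2; 3; 4].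
  by case=> i hi _; apply: (unique_over_sqrt3 hd hr' q hi); exists r.
have u1 : is_adjoin_sqrt k (-1) -> unique_nc_proper_ap [tuple (-2 : K); -1; 0; 1; 2].
  by case=> i hi _; apply: (unique_over_i hd hr' q hi); exists r.
split; last split=> //; last split=> //.
  split=> [[b nb]|[/u3[[a na _] _]|/u1[[a na _] _]|[al [_ _ [x nx _]]]]].
  (* The field is distinguished before [t] is introduced, since the third case must hold for every
     [t] at once. *)
  - have [h3|n3] := classic (is_adjoin_sqrt k 3); first by constructor 1.
    have [h1|n1] := classic (is_adjoin_sqrt k (-1)); first by constructor 2.
    constructor 3; apply: (irrational_fourth_alpha hd hr' q); exists b => // t tw.
    by case: (cl t b tw nb).
  - by exists a.
  - by exists a.
  by exists x.
move=> n3 n1 al [[alk _] _] [s hs full] x nx.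
have st : sqrt_over k s by split; [rewrite hs | apply: full_notin full].
have [//|//|[_ [c xc form]]] := cl s x (tower_of_sqrt hd hr' q st) nx.
by exists (sqs c) => //; rewrite -hs.
Qed.

Lemma five_squares_over_sqrtN2 (K : fieldExtType rat) (r : K) : r ^+ 2 = -2 ->
  let k : {subfield K} := <<1; r>>%AS in
  quadratic_over k ->
  ((exists a : 5.-tuple K, nc_proper_ap a) <->
     (is_adjoin_sqrt k (-1) \/ alpha_case k))
  /\ (is_adjoin_sqrt k (-1) ->
        unique_nc_proper_ap [tuple (-2 : K); -1; 0; 1; 2])
  /\ (~ is_adjoin_sqrt k (-1) -> alpha_form k).
Proof.
move=> hr k q; have hd : -2 \in discriminants by [].
have hr' : r ^+ 2 = (-2)%:~R by rewrite hr.
have cl (t : K) (b : 5.-tuple K) : quadratic_tower (-2) r t -> nc_proper_ap b ->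
    is_adjoin_sqrt k (-1) \/ irrational_fourth (-2) r t (sqs b).
  move=> tw /(tower_classification tw q)[[_ [[i hi] _]]|[_ [[s hs] [i hi]]]|fl].
  - left; exists i => //.
    by case: (@int_sqr_adjoin _ _ (-1) _ i hd hr' q); rewrite // hi.
  - by case: (@not_both_squaresP _ _ 2 3 _ _ s i tw).
  by right.
have u1 : is_adjoin_sqrt k (-1) -> unique_nc_proper_ap [tuple (-2 : K); -1; 0; 1; 2].
  case=> i hi _; apply: (unique_over_i hd hr' q hi); exists (r / i).
  by rewrite exprMn exprVn hr hi invrN1 mulrNN mulr1.
split; last split=> //.
  split=> [[b nb]|[/u1[[a na _] _]|[al [_ _ [x nx _]]]]].
  - have [h1|n1] := classic (is_adjoin_sqrt k (-1)); first by left.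
    right; apply: (irrational_fourth_alpha hd hr' q); exists b => // t tw.
    by case: (cl t b tw nb).
  - by exists a.
  by exists x.
move=> n1 al [[alk _] _] [s hs full] x nx.
have st : sqrt_over k s by split; [rewrite hs | apply: full_notin full].
have [//|[_ [c xc form]]] := cl s x (tower_of_sqrt hd hr' q st) nx.
by exists (sqs c) => //; rewrite -hs.
Qed.

Theorem theorem1p2 (K : fieldExtType rat) :
  (forall r : K, r ^+ 2 = -1 ->
    let k : {subfield K} := <<1; r>>%AS in
    quadratic_over k ->
    ((exists a : 5.-tuple K, nc_proper_ap a) <-> is_adjoin_sqrt k 2)
    /\ (is_adjoin_sqrt k 2 -> unique_nc_proper_ap [tuple (-2 : K); -1; 0; 1; 2]))
  /\
  (forall r : K, r ^+ 2 = 3 ->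
    let k : {subfield K} := <<1; r>>%AS in
    quadratic_over k ->
    ((exists a : 5.-tuple K, nc_proper_ap a) <-> is_adjoin_sqrt k 2)
    /\ (is_adjoin_sqrt k 2 -> unique_nc_proper_ap [tuple (0 : K); 1; 2; 3; 4]))
  /\
  (forall r : K, r ^+ 2 = 2 ->
    let k : {subfield K} := <<1; r>>%AS in
    quadratic_over k ->
    ((exists a : 5.-tuple K, nc_proper_ap a) <->
       [\/ is_adjoin_sqrt k 3, is_adjoin_sqrt k (-1) | alpha_case k])
    /\ (is_adjoin_sqrt k 3 -> unique_nc_proper_ap [tuple (0 : K); 1; 2; 3; 4])
    /\ (is_adjoin_sqrt k (-1) ->
          unique_nc_proper_ap [tuple (-2 : K); -1; 0; 1; 2])
    /\ (~ is_adjoin_sqrt k 3 -> ~ is_adjoin_sqrt k (-1) -> alpha_form k))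
  /\
  (forall r : K, r ^+ 2 = -2 ->
    let k : {subfield K} := <<1; r>>%AS in
    quadratic_over k ->
    ((exists a : 5.-tuple K, nc_proper_ap a) <->
       (is_adjoin_sqrt k (-1) \/ alpha_case k))
    /\ (is_adjoin_sqrt k (-1) ->
          unique_nc_proper_ap [tuple (-2 : K); -1; 0; 1; 2])
    /\ (~ is_adjoin_sqrt k (-1) -> alpha_form k)).
Proof.
split; [exact: five_squares_over_i | split; [exact: five_squares_over_sqrt3 | split]].
  exact: five_squares_over_sqrt2.
exact: five_squares_over_sqrtN2.
Qed.
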